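(* Let $F(z,u)=\sum_{n\ge1}\sum_{0\le m\le n}F_{n,m}\frac{z^nu^{n-m}}{n!\,m!}$ and $\tilde F(z,u)=\sum_{n\ge1}\sum_{0\le m\le n}\tilde F_{n,m}\frac{z^nu^{n-m}}{n!}$. For each tree family, with $\hat Q=\hat Q(z,u)$ the unique formal power series in $z$ (coefficients polynomial in $u$) with $\hat Q(0,u)=0$ satisfying the stated functional equation: General tree parking functions: - ordered: $F=1-\frac{1}{(1-\hat Q)(1+\hat Q+u\hat Q(1-\hat Q))e^{\hat Q}}$, $\hat Q=z(1+\hat Q+u\hat Q(1-\hat Q))^2e^{\hat Q}$; - unordered: $F=\ln(1-\hat Q)+\hat Q(2+u(1-\hat Q))$, $\hat Q=ze^{\hat Q(2+u(1-\hat Q))}$; - $d$-ary: $F=\frac{(1-d\hat Q)^{1/d}e^{\hat Q}}{1-\hat Q-u\hat Q(1-d\hat Q)}-1$, $\hat Q=\frac{ze^{d\hat Q}}{(1-\hat Q-u\hat Q(1-d\hat Q))^{d-1}}$; - $d$-bundled: $F=1-\frac{1}{(1-d\hat Q)^{1/d}(1+\hat Q+u\hat Q(1-d\hat Q))e^{\hat Q}}$, $\hat Q=z(1+\hat Q+u\hat Q(1-d\hat Q))^{d+1}e^{d\hat Q}$. General tree parking distributions: - ordered: $\tilde F=1-\frac{1}{(1-\hat Q)((1+\hat Q)^2+u\hat Q(1-\hat Q))}$, $\hat Q=z((1+\hat Q)^2+u\hat Q(1-\hat Q))^2$; - unordered: $\tilde F=\hat Q+\ln(1+\hat Q)+\ln(1-\hat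 Q)+\frac{u\hat Q(1-\hat Q)}{1+\hat Q}$, $\hat Q=z(1+\hat Q)^2e^{\hat Q\left(1+\frac{u(1-\hat Q)}{1+\hat Q}\right)}$; - $d$-ary: $\tilde F=\frac{(1+\hat Q)^{1/d}(1-\hat Q)^{1/d}}{1-\frac{\hat Q}d-\frac{u\hat Q(1-\hat Q)}{d(1+\hat Q)}}-1$, $\hat Q=\frac{dz(1+\hat Q)^2}{\left(1-\frac{\hat Q}d-\frac{u\hat Q(1-\hat Q)}{d(1+\hat Q)}\right)^{d-1}}$; - $d$-bundled: $\tilde F=1-\frac{1}{(1+\hat Q)^{1/d}(1-\hat Q)^{1/d}\left(1+\frac{\hat Q}d+\frac{u\hat Q(1-\hat Q)}{d(1+\hat Q)}\right)}$, $\hat Q=dz(1+\hat Q)^2\left(1+\frac{\hat Q}d+\frac{u\hat Q(1-\hat Q)}{d(1+\hat Q)}\right)^{d+1}$.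
   Context: All trees are rooted, with the $n$ nodes of a size-$n$ tree labelled by distinct elements of $[n]$, counted as distinct labelled objects, edges oriented towards the root. Families: ordered trees (children ordered); unordered trees (children unordered); $d$-ary trees ($d\ge1$; each node has $d$ distinguishable positions, each empty or holding a child); $d$-bundled trees (each node has $d$ distinguishable positions, each holding an ordered, possibly empty, sequence of children). Parking: for a size-$n$ tree $T$ and $s=(s_1,\dots,s_m)\in[n]^m$, drivers $1,\dots,m$ arrive in order; driver $i$ starts at node $s_i$ and moves towards the root, parking at the first unoccupied node, or leaves without parking if there is none. $(T,s)$ is an $(n,m)$-tree parking function if all $m$ drivers park; an $(n,m)$-tree parking distribution if additionally $s_1\le\dots\le s_m$ (equivalently $s$ is a multiset of size $m$ on $[n]$). $F_{n,m}$ and $\tilde F_{n,m}$ are the total numbers of $(n,m)$-tree parking functions, resp. distributions, with $T$ a size-$n$ tree of the family. *)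

(* Defs.v *)
From HB Require Import structures.
From mathcomp Require Import all_boot all_order all_algebra.
From mathcomp Require Import boolp.

Set Implicit Arguments.
Unset Strict Implicit.
Unset Printing Implicit Defensive.

Import GRing.Theory.
Local Open Scope ring_scope.

(** * Formal power series *)

Record fps (R : Type) := Fps { fcoef :> nat -> R }.

Lemma fpsP (R : Type) (f g : fps R) : f =1 g -> f = g.
Proof. by case: f g => f [g] /= /funext ->. Qed.

HB.instance Definition _ (R : Type) := gen_eqMixin (fps R).
HB.instance Definition _ (R : Type) := gen_choiceMixin (fps R).

Section FpsZmodule.
Variable R : zmodType.
Implicit Types f g h : fps R.

Definition fps_zero : fps R := Fps (fun=> 0).
Definition fps_opp f : fps R := Fps (fun n => - f n).
Definition fps_add f g : fps R := Fps (fun n => f n + g n).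

Lemma fps_addA : associative fps_add.
Proof. by move=> f g h; apply: fpsP => n; apply: addrA. Qed.
Lemma fps_addC : commutative fps_add.
Proof. by move=> f g; apply: fpsP => n; apply: addrC. Qed.
Lemma fps_add0 : left_id fps_zero fps_add.
Proof. by move=> f; apply: fpsP => n; apply: add0r. Qed.
Lemma fps_addN : left_inverse fps_zero fps_opp fps_add.
Proof. by move=> f; apply: fpsP => n; apply: addNr. Qed.

HB.instance Definition _ :=
  GRing.isZmodule.Build (fps R) fps_addA fps_addC fps_add0 fps_addN.
End FpsZmodule.

Section FpsRing.
Variable R : comNzRingType.
Implicit Types f g h : fps R.

Definition fpsC (c : R) : fps R := Fps (fun n => if n == 0%N then c else 0).
Definition fpsX : fps R := Fps (fun n => (n == 1%N)%:R).

Definition fps_one : fps R := fpsC 1.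
Definition fps_mul f g : fps R :=
  Fps (fun n => \sum_(i < n.+1) f i * g (n - i)%N).

Definition fps_trunc N f : {poly R} := \poly_(i < N) f i.

Lemma coef_fps_trunc N f n : (n < N)%N -> (fps_trunc N f)`_n = f n.
Proof. by move=> nN; rewrite coef_poly nN. Qed.

Lemma fps_mul_trunc N f g n : (n < N)%N ->
  fps_mul f g n = (fps_trunc N f * fps_trunc N g)`_n.
Proof.
move=> nN; rewrite coefM; apply: eq_bigr => i _.
rewrite !coef_fps_trunc //; first by apply: leq_ltn_trans nN; rewrite leq_subr.
by apply: leq_trans nN; rewrite ltnS -ltnS.
Qed.

Lemma fps_mulC : commutative fps_mul.
Proof.
by move=> f g; apply: fpsP => n; rewrite !(@fps_mul_trunc n.+1) // mulrC.
Qed.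

Lemma fps_mulA : associative fps_mul.
Proof.
move=> f g h; apply: fpsP => n.
transitivity ((fps_trunc n.+1 f * fps_trunc n.+1 g * fps_trunc n.+1 h)`_n).
  rewrite -mulrA coefM; apply: eq_bigr => i _.
  rewrite coef_fps_trunc // (@fps_mul_trunc n.+1) //.
  by rewrite ltnS leq_subr.
rewrite coefM; apply: eq_bigr => i _.
rewrite -(@fps_mul_trunc n.+1) // coef_fps_trunc //.
by rewrite ltnS leq_subr.
Qed.

Lemma fps_mul1 : left_id fps_one fps_mul.
Proof.
move=> f; apply: fpsP => n /=.
rewrite big_ord_recl /= mul1r subn0 big1 ?addr0 // => i _.
by rewrite mul0r.
Qed.

Lemma fps_mulDl : left_distributive fps_mul +%R.
Proof.
move=> f g h; apply: fpsP => n /=; rewrite -big_split /=.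
by apply: eq_bigr => i _; rewrite mulrDl.
Qed.

Lemma fps_one_neq0 : fps_one != 0.
Proof.
apply/eqP => /(congr1 (fun f : fps R => f 0%N)) /= /eqP.
by rewrite oner_eq0.
Qed.

HB.instance Definition _ := GRing.Zmodule_isComNzRing.Build (fps R)
  fps_mulA fps_mulC fps_mul1 fps_mulDl fps_one_neq0.
End FpsRing.

Section FpsUnitRing.
Variable R : comUnitRingType.
Implicit Types f g : fps R.

Definition fps_unit : {pred fps R} := fun f => f 0%N \is a GRing.unit.

(* The list of the coefficients of degree at most n of the inverse of f. *)
Fixpoint fps_inv_seq f n : seq R :=
  if n is n'.+1 then
    let s := fps_inv_seq f n' in
    rcons s (- ((f 0%N)^-1 * \sum_(i < n) s`_i * f (n - i)%N))
  else [:: (f 0%N)^-1].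

Definition fps_inv f : fps R :=
  if f \in fps_unit then Fps (fun n => (fps_inv_seq f n)`_n) else f.

Lemma size_fps_inv_seq f n : size (fps_inv_seq f n) = n.+1.
Proof. by elim: n => //= n IHn; rewrite size_rcons IHn. Qed.

Lemma nth_fps_inv_seq f n i : (i <= n)%N ->
  (fps_inv_seq f n)`_i = (fps_inv_seq f i)`_i.
Proof.
elim: n => [|n IHn]; first by rewrite leqn0 => /eqP ->.
rewrite leq_eqVlt => /predU1P[-> //|]; rewrite ltnS => le_in.
by rewrite /= nth_rcons size_fps_inv_seq ltnS le_in IHn.
Qed.

Lemma fps_mulVf : {in fps_unit, left_inverse 1 fps_inv *%R}.
Proof.
move=> f fU; apply: fpsP => n; rewrite /fps_inv fU.
have f0U : f 0%N \is a GRing.unit by [].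
case: n => [|n]; first by rewrite /= big_ord_recl big_ord0 addr0 /= mulVr.
rewrite /= big_ord_recr /= nth_rcons size_fps_inv_seq ltnn eqxx subnn.
rewrite mulNr mulrAC mulVr // mul1r; apply/eqP; rewrite subr_eq0; apply/eqP.
by apply: eq_bigr => i _; rewrite (@nth_fps_inv_seq f n) //; apply: (ltn_ord i).
Qed.

Lemma fps_unitPl f g : g * f = 1 -> f \in fps_unit.
Proof.
move=> /(congr1 (fun h : fps R => h 0%N)) /=.
rewrite big_ord_recl big_ord0 addr0 /= => gf1.
by apply/unitrPr; exists (g 0%N); rewrite mulrC.
Qed.

Lemma fps_inv_out : {in [predC fps_unit], fps_inv =1 id}.
Proof. by move=> f; rewrite inE /= /fps_inv => /negbTE ->. Qed.

HB.instance Definition _ := GRing.ComNzRing_hasMulInverse.Build (fps R)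
  fps_mulVf fps_unitPl fps_inv_out.
End FpsUnitRing.

(* Power series in z whose coefficients are polynomials in u over rat. *)
Notation zu_series := (fps {poly rat}).

Definition zvar : zu_series := fpsX _.
Definition uvar : zu_series := fpsC 'X.

(* The substitution sum_k a_k f^k, meaningful when f has constant coefficient
   0: then f^k does not contribute to degree n for k > n. *)
Definition fps_subst (a : nat -> rat) (f : zu_series) : zu_series :=
  Fps (fun n => \sum_(k < n.+1) a k *: (f ^+ k : zu_series) n).

Definition expS (f : zu_series) : zu_series := fps_subst (fun k => (k`!%:R)^-1) f.

(* lnS f and powS f a = f^a are meaningful when f has constant coefficient 1;
   they are the usual expansions in powers of f - 1.  The k = 0 coefficient of
   the logarithm is 0 since 0^-1 = 0 in rat. *)
Definition lnS (f : zu_series) : zu_series :=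
  fps_subst (fun k => (-1) ^+ k.+1 / k%:R) (f - 1).

Definition powS (f : zu_series) (a : rat) : zu_series :=
  fps_subst (fun k => (\prod_(i < k) (a - i%:R)) / k`!%:R) (f - 1).

(** * Labelled rooted trees *)

(* The label set [n] is represented by 'I_n.  A family says which
   configurations of children a node can have; [kids c] lists the children in
   the configuration c. *)
Record family := Family {
  config : nat -> finType;
  kids : forall n, config n -> seq 'I_n
}.

(* No node of a size-n tree has more than n children, so that child lists can
   be taken in the finite type of sequences of length at most n. *)
Definition ordered : family :=
  @Family (fun n => {bseq n of 'I_n} : finType) (fun n c => c).

Definition unordered : family :=
  @Family (fun n => {set 'I_n} : finType) (fun n c => enum c).

Definition d_ary (d : nat) : family :=
  @Family (fun n => {ffun 'I_d -> option 'I_n} : finType)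
          (fun n c => pmap c (enum 'I_d)).

Definition d_bundled (d : nat) : family :=
  @Family (fun n => {ffun 'I_d -> {bseq n of 'I_n}} : finType)
          (fun n c => flatten [seq (c i : seq 'I_n) | i <- enum 'I_d]).

Section Trees.
Variables (A : family) (n : nat).

Definition pretree : finType := {ffun 'I_n -> config A n}.

Implicit Type T : pretree.

(* Every node is, exactly once, either the root r or a child of some node, and
   every node can be reached from r. *)
Definition is_tree T : bool :=
  [exists r : 'I_n,
     perm_eq (r :: flatten [seq kids (T v) | v <- enum 'I_n]) (enum 'I_n) &&
     [forall v, connect (fun x y => y \in kids (T x)) r v]].

Definition parent T (v : 'I_n) : option 'I_n := [pick w | v \in kids (T w)].

(** * Parking *)

(* The first node outside occ on the way from v to the root, if any; k bounds
   the number of nodes visited. *)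
Fixpoint first_free T (occ : {set 'I_n}) (k : nat) (v : 'I_n) : option 'I_n :=
  if k is k'.+1 then
    if v \notin occ then Some v
    else if parent T v is Some w then first_free T occ k' w else None
  else None.

(* The path from a node to the root has at most n nodes. *)
Definition park T (occ : {set 'I_n}) (v : 'I_n) : option 'I_n :=
  first_free T occ n v.

(* The parking positions of the successive drivers with preferences s, the
   nodes in occ being initially occupied; None for a driver who leaves. *)
Fixpoint outcomes T (occ : {set 'I_n}) (s : seq 'I_n) : seq (option 'I_n) :=
  if s is v :: s' then
    let o := park T occ v in
    o :: outcomes T (if o is Some w then w |: occ else occ) s'
  else [::].

Definition parking_function T (s : seq 'I_n) : bool :=
  is_tree T && all isSome (outcomes T set0 s).

Definition parking_distribution T (s : seq 'I_n) : bool :=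
  parking_function T s && sorted (fun i j : 'I_n => (i <= j)%N) s.

End Trees.

Definition num_functions (A : family) (n m : nat) : nat :=
  #|[set Ts : pretree A n * m.-tuple 'I_n | parking_function Ts.1 Ts.2]|.

Definition num_distributions (A : family) (n m : nat) : nat :=
  #|[set Ts : pretree A n * m.-tuple 'I_n | parking_distribution Ts.1 Ts.2]|.

(** * Generating functions *)

Definition gf_functions (A : family) : zu_series :=
  Fps (fun n => if n == 0%N then 0 else
    \sum_(m < n.+1)
      ((num_functions A n m)%:R / (n`!%:R * m`!%:R)) *: 'X^(n - m)).

Definition gf_distributions (A : family) : zu_series :=
  Fps (fun n => if n == 0%N then 0 else
    \sum_(m < n.+1) ((num_distributions A n m)%:R / n`!%:R) *: 'X^(n - m)).

(* F = G(Q), where Q is the unique series with Q(0,u) = 0 and Q = Phi(Q). *)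
Definition given_by (F : zu_series) (G Phi : zu_series -> zu_series) : Prop :=
  exists Q : zu_series,
    unique (fun P : zu_series => P 0%N = 0 /\ P = Phi P) Q /\ F = G Q.

(* Main.v *)
From HB Require Import structures.
From mathcomp Require Import all_boot all_order all_algebra.
From mathcomp Require Import boolp.
From mathcomp Require Import zify ring.
Require Import Defs.
Import GRing.Theory Num.Theory.
Local Open Scope ring_scope.

Set Implicit Arguments.
Unset Strict Implicit.
Unset Printing Implicit Defensive.

(** Let H(z,x) be the generating function of trees with drivers, where x marks the
    drivers that leave the root and u the unoccupied nodes.  If E(x) is the
    series of the drivers preferring a given node (exp x for functions, 1/(1-x)
    for distributions) and a(y) that of the children of a node, then
      x H = z (E(x) a(H) - a(F) + u x a(F)),    F = H(z,0).
    Let X(z) be the series with X = z E(X) a'(Y), Y = H(z,X).  In the derivative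
    of the equation with respect to x, taken at x = X, the terms in dH/dx cancel,
    which leaves Y = z (a(Y) E'(X) + u a(F)), and then
      a(F) = a(Y) (E(X) - X E'(X)).
    Solving for Y gives the eight formulas, with Q = X (or X/d) for functions and
    Q = X/(1-X) for distributions.

    The equation for H comes from labelled plane trees: a node with k children
    reached by c drivers in total sends max(c-1,0) drivers to its parent, and a
    plane forest is a binary tree.  A tree of any family is an ordered tree up to
    the order of the children, and ordered trees on [n] are plane trees of size n
    together with a permutation of [n]. *)

(** * Power series: congruence modulo powers of the variable, evaluation *)

(** Parking is defined by drivers who arrive one after the other, whereas a recursion on trees needs
    a quantity computed from the leaves upwards. The bridge is that moving a driver from an occupied
    node to its parent does not change how many drivers leave, so this number depends only on how
    many drivers prefer each node. Sequences can thus be grouped by these numbers c_v, and the kind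
    of sequence matters only through the size of a group: m!/prod c_v! for functions, 1 for
    distributions. This product form is the origin of E. When nobody leaves, n - m is the number of
    free nodes, so u can be attached to single nodes.

    The equation for H has two unknowns, H and F. The series X exists because its equation carries a
    factor z, and substituting it is legitimate because its constant coefficient is 0. Afterwards z
    is eliminated between the equations of X and Y, and the logarithms and d-th roots in the
    formulas are verified by exponentiating or by taking d-th powers, the constant coefficients
    being known. *)

Definition eqm (R : Type) (N : nat) (f g : fps R) :=
  forall n, (n < N)%N -> f n = g n.

Section Coefficients.
Variable R : comNzRingType.
Implicit Types f g h : fps R.

Lemma coef_mulE f g n : (f * g) n = \sum_(i < n.+1) f i * g (n - i)%N.
Proof. by []. Qed.

Lemma coef_mul0 f g : (f * g) 0%N = f 0%N * g 0%N.
Proof. by rewrite coef_mulE big_ord_recl big_ord0 addr0. Qed.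

Lemma coef_sumE (I : Type) (r : seq I) (P : pred I) (F : I -> fps R) n :
  (\sum_(i <- r | P i) F i) n = \sum_(i <- r | P i) F i n.
Proof. by elim/big_rec2: _ => // i y1 y2 _ <-. Qed.

Lemma fpsC_is_zmod_morphism : zmod_morphism (@fpsC R).
Proof.
by move=> a b; apply: fpsP => n /=; case: (n == 0%N); rewrite ?subr0.
Qed.

Lemma fpsC_is_monoid_morphism : monoid_morphism (@fpsC R).
Proof.
split=> // a b; apply: fpsP => n; rewrite coef_mulE big_ord_recl /= subn0.
rewrite big1 => [|i _]; last by rewrite /= mul0r.
by case: (n == 0%N); rewrite ?mulr0 addr0.
Qed.

HB.instance Definition _ :=
  GRing.isZmodMorphism.Build R (fps R) (@fpsC R) fpsC_is_zmod_morphism.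
HB.instance Definition _ :=
  GRing.isMonoidMorphism.Build R (fps R) (@fpsC R) fpsC_is_monoid_morphism.

Definition const_coef f : R := f 0%N.

Lemma const_coef_is_zmod_morphism : zmod_morphism const_coef.
Proof. by []. Qed.

Lemma const_coef_is_monoid_morphism : monoid_morphism const_coef.
Proof. by split=> // f g; apply: coef_mul0. Qed.

HB.instance Definition _ :=
  GRing.isZmodMorphism.Build (fps R) R const_coef const_coef_is_zmod_morphism.
HB.instance Definition _ :=
  GRing.isMonoidMorphism.Build (fps R) R const_coef const_coef_is_monoid_morphism.

Lemma coef_exp0 f n : (f ^+ n) 0%N = f 0%N ^+ n.
Proof. exact: (rmorphXn (@const_coef)). Qed.

Lemma coef_mulC c f n : (fpsC c * f) n = c * f n.
Proof.
rewrite coef_mulE big_ord_recl /= subn0 big1 ?addr0 // => i _.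
by rewrite /= mul0r.
Qed.

Lemma coef_mulX f n : (fpsX R * f) n = if n is n'.+1 then f n' else 0.
Proof.
case: n => [|n]; first by rewrite coef_mul0 mul0r.
rewrite coef_mulE 2!big_ord_recl big1 => [|i _]; last by rewrite /= mul0r.
by rewrite /= mul0r mul1r add0r addr0 /bump /= add1n subSS subn0.
Qed.

Lemma coef_fpsXn k n : (fpsX R ^+ k) n = (n == k)%:R.
Proof.
elim: k n => [|k IHk] n; first by rewrite expr0 /=; case: n.
by rewrite exprS coef_mulX; case: n => //= n; rewrite IHk eqSS.
Qed.

Lemma coef_nat (k n : nat) : (k%:R : fps R) n = if n == 0%N then k%:R else 0.
Proof. by rewrite -(rmorph_nat (@fpsC R)). Qed.
End Coefficients.

Section Congruence.
Variable R : comNzRingType.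
Implicit Types f g h : fps R.

Lemma eqm_refl N f : eqm N f f.
Proof. by []. Qed.

Lemma eqm_trans N f g h : eqm N f g -> eqm N g h -> eqm N f h.
Proof. by move=> fg gh n nN; rewrite fg // gh. Qed.

Lemma eqm_sym N f g : eqm N f g -> eqm N g f.
Proof. by move=> fg n nN; rewrite fg. Qed.

Lemma eqm_leq M N f g : (M <= N)%N -> eqm N f g -> eqm M f g.
Proof. by move=> MN fg n nM; apply: fg; apply: leq_trans MN. Qed.

Lemma eqm_eq f g : (forall N, eqm N f g) -> f = g.
Proof. by move=> fg; apply: fpsP => n; apply: (fg n.+1). Qed.

Lemma eqmD N f f' g g' : eqm N f f' -> eqm N g g' -> eqm N (f + g) (f' + g').
Proof. by move=> ff gg n nN /=; rewrite ff ?gg. Qed.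

Lemma eqmN N f f' : eqm N f f' -> eqm N (- f) (- f').
Proof. by move=> ff n nN /=; rewrite ff. Qed.

Lemma eqmM N f f' g g' : eqm N f f' -> eqm N g g' -> eqm N (f * g) (f' * g').
Proof.
move=> ff gg n nN; apply: eq_bigr => i _; rewrite ff ?gg //.
  by apply: leq_ltn_trans nN; apply: leq_subr.
by apply: leq_trans nN; apply: ltn_ord.
Qed.

Lemma eqmX N f f' k : eqm N f f' -> eqm N (f ^+ k) (f' ^+ k).
Proof. by move=> ff; elim: k => // k IHk; rewrite !exprS; apply: eqmM. Qed.

Lemma eqm_sum N (I : Type) (r : seq I) (P : pred I) (F G : I -> fps R) :
  (forall i, P i -> eqm N (F i) (G i)) ->
  eqm N (\sum_(i <- r | P i) F i) (\sum_(i <- r | P i) G i).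
Proof. by move=> FG n nN; rewrite !coef_sumE; apply: eq_bigr => i /FG ->. Qed.

Lemma eqm_mulX N f g : eqm N f g -> eqm N.+1 (fpsX R * f) (fpsX R * g).
Proof. by move=> fg [|n] nN; rewrite !coef_mulX // fg. Qed.

Lemma eqmM0 M N f g : eqm M f 0 -> eqm N g 0 -> eqm (M + N) (f * g) 0.
Proof.
move=> f0 g0 n nMN; rewrite coef_mulE big1 // => i _.
have [iM|Mi] := ltnP i M; first by rewrite f0 ?mul0r.
by rewrite g0 ?mulr0 //; have := ltn_ord i; lia.
Qed.

Lemma eqm_expr0 f k : f 0%N = 0 -> eqm k (f ^+ k) 0.
Proof.
move=> f0; elim: k => // k IHk; rewrite exprS -add1n; apply: eqmM0 => // n.
by rewrite ltnS leqn0 => /eqP ->.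
Qed.

Lemma eqm_sum_widen N M (F : nat -> fps R) : (N <= M)%N ->
  (forall k, (N <= k)%N -> eqm N (F k) 0) ->
  eqm N (\sum_(k < M) F k) (\sum_(k < N) F k).
Proof.
move=> NM F0; rewrite -(subnKC NM) big_split_ord /=.
rewrite -[X in eqm _ _ X]addr0; apply: eqmD => //.
elim/big_rec: _ => // i g _ g0; rewrite -[0]addr0; apply: eqmD => //.
by apply: F0; rewrite leq_addr.
Qed.
End Congruence.
#[global] Hint Resolve eqm_refl : core.

Section Inverse.
Variable R : comUnitRingType.
Implicit Types f g h : fps R.

Lemma fps_unitE f : (f \is a GRing.unit) = (f 0%N \is a GRing.unit).
Proof. by []. Qed.

(** For [N > 0] the constant coefficients agree, so both series are invertible or neither is; in the
    second case the inverse is by convention the series itself. *)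
Lemma eqmV N f f' : eqm N f f' -> eqm N f^-1 f'^-1.
Proof.
case: N => // N ff; have [fU|fN] := boolP (f \is a GRing.unit); last first.
  by rewrite !invr_out // fps_unitE -ff.
have f'U : f' \is a GRing.unit by rewrite fps_unitE -ff.
rewrite -[f'^-1](mulKr fU) -[X in eqm _ X]mulr1 -(mulrV f'U).
by apply: eqmM => //; apply: eqmM => //; apply: eqm_sym.
Qed.
End Inverse.

(* Evaluation is sealed, lest unification start computing with coefficients. *)
Fact evalf_spec : {e : forall R S : comNzRingType,
    {rmorphism R -> fps S} -> fps S -> fps R -> fps S |
  forall (R S : comNzRingType) (phi : {rmorphism R -> fps S}) (X : fps S) (f : fps R) n,
    e R S phi X f n = \sum_(k < n.+1) (phi (f k) * X ^+ k) n}.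
Proof.
by exists (fun (R S : comNzRingType) (phi : {rmorphism R -> fps S}) X (f : fps R) =>
  Fps (fun n => \sum_(k < n.+1) (phi (f k) * X ^+ k) n)).
Qed.

Section Evaluation.
Variables (R S : comNzRingType) (phi : {rmorphism R -> fps S}) (X : fps S).
Implicit Types f g : fps R.

(** [phi] sends coefficients to series rather than to scalars. With [qz] this gives substitution
    into a rational series; with [evS] it substitutes for [x] inside the coefficients of a series in
    [z]. *)
Definition evalf : fps R -> fps S := sval evalf_spec R S phi X.

Lemma coef_evalf f n : evalf f n = \sum_(k < n.+1) (phi (f k) * X ^+ k) n.
Proof. exact: (svalP evalf_spec). Qed.

Hypothesis X0 : X 0%N = 0.

Lemma eqm_evalf N f : eqm N (evalf f) (\sum_(k < N) phi (f k) * X ^+ k).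
Proof.
move=> n nN; have := @eqm_sum_widen S n.+1 N (fun k => phi (f k) * X ^+ k) nN.
move=> -> //; first by rewrite coef_evalf coef_sumE.
move=> k nk; rewrite -[0](mulr0 (phi (f k))); apply: eqmM => //.
by apply: eqm_leq nk _; apply: eqm_expr0.
Qed.

Lemma eqm_evalf_trunc N f :
  eqm N (evalf f) (map_poly phi (fps_trunc N f)).[X].
Proof.
move=> n nN; rewrite (eqm_evalf _ nN) (@horner_coef_wide _ N); last first.
  by rewrite (leq_trans (size_poly _ _)) ?size_poly.
by congr (fcoef _ n); apply: eq_bigr => i _; rewrite coef_map coef_fps_trunc.
Qed.

Lemma evalf_congr N f g : eqm N f g -> eqm N (evalf f) (evalf g).
Proof.
move=> fg; apply: eqm_trans (@eqm_evalf N f) _.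
apply: eqm_trans (eqm_sym (@eqm_evalf N g)).
by apply: eqm_sum => i _; rewrite fg.
Qed.

Lemma evalf_poly (p : {poly R}) f : (forall k, f k = p`_k) ->
  evalf f = (map_poly phi p).[X].
Proof.
move=> fp; apply: eqm_eq => N.
apply: (eqm_leq (leq_maxl N (size p))); apply: eqm_trans (@eqm_evalf _ f) _.
move=> n nN; congr (fcoef _ n); rewrite (@horner_coef_wide _ (maxn N (size p))).
  by apply: eq_bigr => i _; rewrite coef_map /= fp.
by rewrite (leq_trans (size_poly _ _)) ?leq_maxr.
Qed.

Lemma evalf_is_zmod_morphism : zmod_morphism evalf.
Proof.
move=> f g; apply: fpsP => n.
transitivity (evalf f n - evalf g n) => //.
rewrite !coef_evalf -sumrB; apply: eq_bigr => k _.
transitivity ((phi (f k - g k) * X ^+ k) n) => //.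
by rewrite rmorphB mulrBl.
Qed.

Lemma evalfC c : evalf (fpsC c) = phi c.
Proof.
rewrite (@evalf_poly c%:P) ?map_polyC ?hornerC // => k.
by rewrite coefC.
Qed.

Lemma evalfX : evalf (fpsX R) = X.
Proof.
rewrite (@evalf_poly 'X) ?map_polyX ?hornerX // => k.
by rewrite coefX.
Qed.

(** Below degree [N] both factors can be replaced by truncations, for which evaluation is that of
    polynomials and hence multiplicative. *)
Lemma evalf_is_monoid_morphism : monoid_morphism evalf.
Proof.
split; first by rewrite -[1](@rmorph1 _ _ (@fpsC R)) evalfC rmorph1.
move=> f g; apply: eqm_eq => N.
apply: eqm_trans (eqm_sym (eqmM (@eqm_evalf_trunc N f) (@eqm_evalf_trunc N g))).
pose p := fps_trunc N f * fps_trunc N g.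
rewrite -hornerM -rmorphM /=.
rewrite -(@evalf_poly p (Fps (fun k => p`_k))) //; apply: evalf_congr => n nN.
exact: fps_mul_trunc.
Qed.

End Evaluation.

Section EvaluationMorphism.
Variables (R S : comNzRingType) (phi : {rmorphism R -> fps S}) (X : fps S).
Hypothesis X0 : X 0%N = 0.

Let e := evalf phi X.

#[local] HB.instance Definition _ :=
  GRing.isZmodMorphism.Build (fps R) (fps S) e (@evalf_is_zmod_morphism _ _ phi X).
#[local] HB.instance Definition _ :=
  GRing.isMonoidMorphism.Build (fps R) (fps S) e (evalf_is_monoid_morphism phi X0).

Definition ev : {rmorphism fps R -> fps S} := e.

Lemma evalfD f g : evalf phi X (f + g) = evalf phi X f + evalf phi X g.
Proof. exact: (rmorphD ev). Qed.

Lemma evalfB f g : evalf phi X (f - g) = evalf phi X f - evalf phi X g.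
Proof. exact: (rmorphB ev). Qed.

Lemma evalfM f g : evalf phi X (f * g) = evalf phi X f * evalf phi X g.
Proof. exact: (rmorphM ev). Qed.

Lemma evalf1 : evalf phi X 1 = 1.
Proof. exact: (rmorph1 ev). Qed.

Lemma evalf_nat n : evalf phi X n%:R = n%:R.
Proof. exact: (rmorph_nat ev). Qed.

Lemma evalf_exp n f : evalf phi X (f ^+ n) = evalf phi X f ^+ n.
Proof. exact: (rmorphXn ev). Qed.
End EvaluationMorphism.

Lemma evalf0 (R S : comNzRingType) (phi : {rmorphism R -> fps S}) X f :
  evalf phi X f 0%N = phi (f 0%N) 0%N.
Proof.
by rewrite coef_evalf big_ord1 expr0 mulr1.
Qed.

Lemma eqm_evalf_arg (R S : comNzRingType) (phi : {rmorphism R -> fps S}) X Y f N :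
  eqm N X Y -> eqm N (evalf phi X f) (evalf phi Y f).
Proof.
move=> XY n nN; rewrite !coef_evalf; apply: eq_bigr => k _.
by apply: (eqmM (N := N)) => //; apply: eqmX.
Qed.

Section MapCoefficients.
Variables (R S : comNzRingType) (phi : {rmorphism R -> S}).

Definition map_fps (f : fps R) : fps S := Fps (fun n => phi (f n)).

Lemma map_fps_is_zmod_morphism : zmod_morphism map_fps.
Proof. by move=> f g; apply: fpsP => n; apply: rmorphB. Qed.

Lemma map_fps_is_monoid_morphism : monoid_morphism map_fps.
Proof.
split=> [|f g]; apply: fpsP => n.
  by rewrite /= (fun_if phi) rmorph0 rmorph1.
transitivity (phi ((f * g) n)) => //; rewrite !coef_mulE rmorph_sum.
by apply: eq_bigr => i _; rewrite rmorphM.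
Qed.

HB.instance Definition _ :=
  GRing.isZmodMorphism.Build (fps R) (fps S) map_fps map_fps_is_zmod_morphism.
HB.instance Definition _ :=
  GRing.isMonoidMorphism.Build (fps R) (fps S) map_fps map_fps_is_monoid_morphism.
End MapCoefficients.

(** * Derivations, the chain rule and fixed points *)

Section Derivations.
Variable R : comNzRingType.

(** The third clause is continuity with the loss of one degree. It lets a derivation pass through
    the infinite sum of an evaluation, and it covers both [dz], which loses a degree, and the
    coefficientwise [map_deriv], which loses none. *)
Definition derivation (D : fps R -> fps R) :=
  [/\ zmod_morphism D, forall f g, D (f * g) = D f * g + f * D g
    & forall N f, eqm N.+1 f 0 -> eqm N (D f) 0].

Definition dz (f : fps R) : fps R := Fps (fun n => f n.+1 *+ n.+1).

Lemma dz_derivation : derivation dz.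
Proof.
split=> [f g|f g|N f f0 n nN]; last by rewrite /= f0 ?mul0rn.
  by apply: fpsP => n; apply: mulrnBl.
apply: fpsP => n.
transitivity (\sum_(i < n.+2) (f i * g (n.+1 - i)%N) *+ n.+1).
  by rewrite /= sumrMnl.
transitivity (\sum_(i < n.+2) ((f i *+ i) * g (n.+1 - i)%N
             + f i * (g (n.+1 - i)%N *+ (n.+1 - i)))).
  apply: eq_bigr => i _.
  by rewrite mulrnAl mulrnAr -mulrnDr subnKC // -ltnS.
rewrite big_split /=; congr (_ + _).
  rewrite big_ord_recl mulr0n mul0r add0r.
  by apply: eq_bigr => i _; rewrite /= /bump /= add1n subSS.
rewrite big_ord_recr /= subnn mulr0n mulr0 addr0.
apply: eq_bigr => i _ /=.
by have /= := ltn_ord i; rewrite ltnS => ni; rewrite subSn.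
Qed.

Section DerivationTheory.
Variables (D : fps R -> fps R) (derD : derivation D).

Lemma der_sub f g : D (f - g) = D f - D g.
Proof. by have [DB _ _] := derD; apply: DB. Qed.

Lemma der0 : D 0 = 0. Proof. by rewrite -[X in D X](subrr 0) der_sub subrr. Qed.

Lemma der_opp f : D (- f) = - D f.
Proof. by rewrite -sub0r der_sub der0 sub0r. Qed.

Lemma der_add f g : D (f + g) = D f + D g.
Proof. by rewrite -{1}[g]opprK der_sub der_opp opprK. Qed.

Lemma der_mul f g : D (f * g) = D f * g + f * D g.
Proof. by have [_ DM _] := derD; apply: DM. Qed.

Lemma der1 : D 1 = 0.
Proof.
by apply: (addrI (D 1)); rewrite addr0 -{3}[1](mulr1 1) der_mul mulr1 mul1r.
Qed.

Lemma der_exp f n : D (f ^+ n.+1) = n.+1%:R * f ^+ n * D f.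
Proof.
elim: n => [|n IHn]; first by rewrite expr1 expr0 !mul1r.
by rewrite exprS der_mul IHn -[n.+2]add1n natrD [_ ^+ n.+1]exprS; ring.
Qed.

Lemma der_sum (I : Type) (r : seq I) (P : pred I) (F : I -> fps R) :
  D (\sum_(i <- r | P i) F i) = \sum_(i <- r | P i) D (F i).
Proof.
by elim/big_rec2: _ => [|i f g _ <-]; [apply: der0 | rewrite der_add].
Qed.

Lemma der_eqm N f g : eqm N.+1 f g -> eqm N (D f) (D g).
Proof.
move=> fg; have fg0 : eqm N (D (f - g)) 0.
  by case: derD => _ _; apply=> n nN /=; rewrite fg ?addrN.
rewrite -[f](subrK g) der_add -[X in eqm _ _ X]add0r.
exact: eqmD.
Qed.
End DerivationTheory.
End Derivations.

Section MapDerivation.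
Variable R : comNzRingType.

Definition map_deriv (D : R -> R) (f : fps R) : fps R := Fps (fun n => D (f n)).

Lemma map_derivation (D : R -> R) : zmod_morphism D ->
  (forall f g, D (f * g) = D f * g + f * D g) -> derivation (map_deriv D).
Proof.
move=> DB DM; have D0 : D 0 = 0 by rewrite -[X in D X](subrr 0) DB subrr.
have DD a b : D (a + b) = D a + D b.
  by rewrite -{1}[b]opprK DB -[- b]sub0r DB D0 sub0r opprK.
split=> [f g|f g|N f f0 n nN]; last by rewrite /= (f0 n (leqW nN)) D0.
  by apply: fpsP => n; apply: DB.
apply: fpsP => n; transitivity (D ((f * g) n)) => //.
transitivity ((map_deriv D f * g) n + (f * map_deriv D g) n) => //.
rewrite !coef_mulE -big_split /=.
rewrite (big_morph D DD D0); apply: eq_bigr => i _; exact: DM.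
Qed.
End MapDerivation.

Section Chain.
Variables (R S : comNzRingType) (phi : {rmorphism R -> fps S}).
Variables (D : fps S -> fps S) (derD : derivation D).
Hypothesis Dphi : forall c, D (phi c) = 0.

Lemma chain_rule (X : fps S) f : X 0%N = 0 ->
  D (evalf phi X f) = evalf phi X (dz f) * D X.
Proof.
move=> X0; apply: eqm_eq => N.
apply: eqm_trans (der_eqm derD (@eqm_evalf _ _ phi X X0 _ f)) _.
apply: eqm_trans (eqmM (eqm_sym (@eqm_evalf _ _ phi X X0 N (dz f))) (@eqm_refl _ N _)).
move=> n _; congr (fcoef _ n).
rewrite (der_sum derD) big_ord_recl expr0 mulr1 Dphi add0r mulr_suml.
apply: eq_bigr => k _; rewrite (der_mul derD) Dphi mul0r add0r.
rewrite (der_exp derD) /= /bump /= add1n.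
have -> : phi (f k.+1 *+ k.+1) = k.+1%:R * phi (f k.+1).
  by rewrite rmorphMn /= mulr_natl.
by ring.
Qed.
End Chain.

Section FixedPoint.
Variable R : comNzRingType.

(* Phi f modulo z^(N+1) only depends on f modulo z^N. *)
Definition contracting (Phi : fps R -> fps R) :=
  (forall f : fps R, f 0%N = 0 -> Phi f 0%N = 0) /\
  (forall N (f g : fps R), f 0%N = 0 -> g 0%N = 0 -> eqm N f g ->
     eqm N.+1 (Phi f) (Phi g)).

Lemma fixpoint_unique Phi (f g : fps R) : contracting Phi ->
  f 0%N = 0 -> g 0%N = 0 -> f = Phi f -> g = Phi g -> f = g.
Proof.
move=> [_ cP] f0 g0 fP gP; apply: eqm_eq; elim=> // N IHN.
by rewrite fP gP; apply: cP.
Qed.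

(** Each iteration from 0 settles one more coefficient, so coefficient [n] is stationary from the
    iterate [n.+1] on; the fixed point is the diagonal of these values. *)
Lemma fixpoint_exists Phi : contracting Phi ->
  exists f : fps R, f 0%N = 0 /\ f = Phi f.
Proof.
move=> [P0 cP]; pose a k := iter k Phi 0.
have a0 k : a k 0%N = 0 by elim: k => // k IHk; apply: P0.
have aS k : eqm k (a k) (a k.+1).
  by elim: k => // k IHk; exact: (cP _ _ _ (a0 k) (a0 k.+1) IHk).
have a_le k m : (k <= m)%N -> eqm k (a k) (a m).
  elim: m => [|m IHm]; first by rewrite leqn0 => /eqP ->.
  rewrite leq_eqVlt => /predU1P[-> //|]; rewrite ltnS => km.
  by apply: eqm_trans (IHm km) _; apply: eqm_leq km _.
pose f : fps R := Fps (fun n => a n.+1 n).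
have fa k : eqm k f (a k).
  by move=> n nk; rewrite /f /=; apply: (a_le n.+1).
have f0 : f 0%N = 0 by apply: a0.
exists f; split=> //; apply: eqm_eq => -[//|N].
by apply: eqm_trans (fa _) _; apply: cP => //; apply: eqm_sym.
Qed.
End FixedPoint.

(** * Exponential, logarithm and powers of series in z *)

Definition qz : {rmorphism rat -> zu_series} :=
  (@fpsC {poly rat} \o polyC : {rmorphism rat -> zu_series}).

Lemma fps_substE (a : nat -> rat) (f : zu_series) :
  fps_subst a f = evalf qz f (Fps a).
Proof.
apply: fpsP => n; rewrite coef_evalf; apply: eq_bigr => k _.
by rewrite coef_mulC mul_polyC.
Qed.

Lemma dz_qz c : dz (qz c) = 0.
Proof. by apply: fpsP => n; rewrite /= mul0rn. Qed.

Lemma polyrat_mulrn_eq0 (p : {poly rat}) n : p *+ n.+1 = 0 -> p = 0.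
Proof.
move/eqP; rewrite -mulr_natr -polyC_natr mulrC mul_polyC scaler_eq0.
by rewrite pnatr_eq0 /= => /eqP.
Qed.

Lemma dz_eq0 (f : zu_series) : dz f = 0 -> f = fpsC (f 0%N).
Proof.
move=> df; apply: fpsP => -[//|n] /=.
exact: polyrat_mulrn_eq0 (congr1 (fun g : zu_series => g n) df).
Qed.

Lemma unit_const1 (f : zu_series) : f 0%N = 1 -> f \is a GRing.unit.
Proof. by move=> f0; rewrite fps_unitE f0 unitr1. Qed.

(** The hypothesis says that [f / g] has derivative 0, hence is constant in characteristic 0. The
    addition law of [expz], [expz_lnz] and the lemmas on d-th roots rest on it. *)
Lemma ode_unique (f g : zu_series) : f 0%N = 1 -> g 0%N = 1 ->
  dz f * g = f * dz g -> f = g.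
Proof.
move=> f0 g0 fg; have gU := unit_const1 g0.
pose h := f / g; have fE : f = h * g by rewrite divrK.
have dM := der_mul (dz_derivation _).
have : dz h * g * g = 0.
  move: fg; rewrite fE dM => /eqP.
  by rewrite -subr_eq0 => /eqP <-; ring.
move/(canRL (mulrK gU)); rewrite mul0r => /(canRL (mulrK gU)); rewrite mul0r.
move/dz_eq0 => hC; rewrite fE hC.
have : const_coef f = h 0%N * g 0%N by rewrite /const_coef fE coef_mul0.
by rewrite /const_coef f0 g0 mulr1 => <-; rewrite mul1r.
Qed.

Section Exponential.
Implicit Types f g : zu_series.

Definition exp_series : fps rat := Fps (fun k => (k`!%:R)^-1).

Lemma dz_exp_series : dz exp_series = exp_series.
Proof.
apply: fpsP => n /=; rewrite factS natrM invfM -[LHS]mulr_natl mulrA divff ?mul1r //.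
by rewrite pnatr_eq0.
Qed.

Definition expz f : zu_series := evalf qz f exp_series.

Lemma expSE f : expS f = expz f.
Proof. exact: fps_substE. Qed.

Lemma expz_coef0 f : expz f 0%N = 1.
Proof. by rewrite /expz evalf0 /= fact0 invr1. Qed.

Lemma dz_expz f : f 0%N = 0 -> dz (expz f) = expz f * dz f.
Proof.
move=> f0; rewrite /expz (chain_rule (dz_derivation _) dz_qz) //.
by rewrite dz_exp_series.
Qed.

Lemma expz_unit f : expz f \is a GRing.unit.
Proof. exact/unit_const1/expz_coef0. Qed.

Lemma expz_D f g : f 0%N = 0 -> g 0%N = 0 -> expz (f + g) = expz f * expz g.
Proof.
move=> f0 g0; have dd := dz_derivation {poly rat}.
have fg0 : (f + g) 0%N = 0 by rewrite /= f0 g0 addr0.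
apply: ode_unique; first exact: expz_coef0.
  by rewrite coef_mul0 !expz_coef0 mulr1.
rewrite (der_mul dd) (dz_expz f0) (dz_expz g0) (dz_expz fg0) (der_add dd).
move: (expz f) (expz g) (expz _) (dz f) (dz g) => a b c a' b'.
ring.
Qed.

(** Formulas with logarithms are checked through this lemma. Differentiating and cancelling the
    exponential gives [dz f = dz g]. *)
Lemma expz_inj f g : f 0%N = 0 -> g 0%N = 0 -> expz f = expz g -> f = g.
Proof.
move=> f0 g0 fg; have := congr1 (@dz _) fg.
rewrite !dz_expz // fg => /(can_inj (mulKr (expz_unit g))) dfg.
apply/eqP; rewrite -subr_eq0; apply/eqP.
rewrite [LHS]dz_eq0 ?(der_sub (dz_derivation _)) ?dfg ?subrr //.
by apply: fpsP => -[|n] //=; rewrite f0 g0 subrr.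
Qed.

Lemma expz_congr N f g : eqm N f g -> eqm N (expz f) (expz g).
Proof. by move=> fg; rewrite /expz; apply: eqm_evalf_arg. Qed.

Lemma expz_nat n f : f 0%N = 0 -> expz (n%:R * f) = expz f ^+ n.
Proof.
move=> f0; elim: n => [|n IHn].
  rewrite mul0r expr0; apply: fpsP => -[|n].
    by rewrite expz_coef0.
  have d0 : dz (expz 0) = 0.
    by rewrite dz_expz // (der0 (dz_derivation _)) mulr0.
  exact: polyrat_mulrn_eq0 (congr1 (fun g : zu_series => g n) d0).
rewrite -add1n natrD mulrDl mul1r expz_D ?IHn ?exprS //.
by rewrite coef_mul0 f0 mulr0.
Qed.
End Exponential.

Section LogarithmAndPowers.
Implicit Types f g : zu_series.

Let one_plus_X : fps rat := 1 + fpsX _.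

Lemma sub1_coef0 f : f 0%N = 1 -> (f - 1) 0%N = 0.
Proof. by move=> f0; rewrite /= f0 subrr. Qed.

Lemma coef_1X (a : fps rat) n :
  (one_plus_X * a) n = a n + (if n is n'.+1 then a n' else 0).
Proof. by rewrite mulrDl mul1r -(coef_mulX a). Qed.

Lemma eval_1X f : f 0%N = 1 -> evalf qz (f - 1) one_plus_X = f.
Proof.
move=> f0; have f1 := sub1_coef0 f0.
by rewrite (evalfD qz f1) (evalf1 qz f1) (evalfX qz f1) addrC subrK.
Qed.

Definition ln_series : fps rat := Fps (fun k => (-1) ^+ k.+1 / k%:R).
Definition pow_series (a : rat) : fps rat :=
  Fps (fun k => (\prod_(i < k) (a - i%:R)) / k`!%:R).
Definition lnz f : zu_series := evalf qz (f - 1) ln_series.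
Definition powz f a : zu_series := evalf qz (f - 1) (pow_series a).

Lemma lnSE f : lnS f = lnz f. Proof. exact: fps_substE. Qed.

Lemma powSE f a : powS f a = powz f a. Proof. exact: fps_substE. Qed.

Lemma lnz_coef0 f : lnz f 0%N = 0.
Proof. by rewrite /lnz evalf0 /= invr0 mulr0. Qed.

Lemma dz_sub1 f : dz (f - 1) = dz f.
Proof.
by rewrite (der_sub (dz_derivation _)) (der1 (dz_derivation _)) subr0.
Qed.

Lemma dz_lnz f : f 0%N = 1 -> f * dz (lnz f) = dz f.
Proof.
move=> f0; have f1 := sub1_coef0 f0.
rewrite /lnz (chain_rule (dz_derivation _) dz_qz) // dz_sub1.
rewrite -{1}(eval_1X f0) mulrA -(evalfM qz f1).
suff -> : one_plus_X * dz ln_series = 1 by rewrite (evalf1 qz f1) mul1r.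
have da n : dz ln_series n = (-1) ^+ n.
  rewrite [LHS]/= -[LHS]mulr_natr mulfVK ?pnatr_eq0 //.
  by rewrite !exprS !mulN1r opprK.
apply: fpsP => n; rewrite coef_1X da; case: n => [|n]; first by rewrite addr0.
by rewrite da exprS mulN1r addNr.
Qed.

Lemma expz_lnz f : f 0%N = 1 -> expz (lnz f) = f.
Proof.
move=> f0; apply: ode_unique; rewrite ?expz_coef0 //.
by rewrite dz_expz ?lnz_coef0 // -(dz_lnz f0); ring.
Qed.

Lemma powz_coef0 f a : powz f a 0%N = 1.
Proof. by rewrite /powz evalf0 /= big_ord0 fact0 divr1. Qed.

(** The recurrence (m + 1) b_(m+1) = (a - m) b_m of the binomial coefficients is the differential
    equation (1 + X) b' = a b read coefficient by coefficient. *)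
Lemma dz_powz f a : f 0%N = 1 -> f * dz (powz f a) = qz a * powz f a * dz f.
Proof.
move=> f0; have f1 := sub1_coef0 f0; rewrite /powz.
rewrite (chain_rule (dz_derivation _) dz_qz) // dz_sub1.
rewrite -{1}(eval_1X f0) mulrA -(evalfM qz f1).
suff -> : one_plus_X * dz (pow_series a) = fpsC a * pow_series a.
  by rewrite (evalfM qz f1) (evalfC qz f1).
apply: fpsP => n; rewrite coef_1X coef_mulC; set b := pow_series a.
have db m : b m.+1 *+ m.+1 = (a - m%:R) * b m.
  rewrite /b /= big_ord_recr factS /= natrM invfM -[LHS]mulr_natr.
  have m0 : (m.+1%:R : rat) != 0 by rewrite pnatr_eq0.
  rewrite -[RHS](mulKf m0); set M := m.+1%:R; set F := m`!%:R^-1.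
  by set P := \prod_(i < m) _; ring.
transitivity ((a - n%:R) * b n + (if n is n'.+1 then dz b n' else 0)).
  by rewrite -db.
case: n => [|n]; first by rewrite subr0 addr0.
by rewrite mulrBl mulr_natl subrK.
Qed.

Lemma powz_root f d : (0 < d)%N -> f 0%N = 1 -> powz f d%:R^-1 ^+ d = f.
Proof.
case: d => // d _ f0; have dd := dz_derivation {poly rat}.
set p := powz f _.
have p0 : p 0%N = 1 by apply: powz_coef0.
have dp : f * dz p = qz d.+1%:R^-1 * p * dz f by apply: dz_powz.
have dq : (d.+1%:R : zu_series) * qz d.+1%:R^-1 = 1.
  by rewrite -(rmorph_nat qz) -rmorphM divff ?rmorph1 // pnatr_eq0.
apply: ode_unique => //; first by rewrite coef_exp0 p0 expr1n.
rewrite (der_exp dd) exprS.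
transitivity (d.+1%:R * p ^+ d * (f * dz p)); first by ring.
rewrite dp.
transitivity ((d.+1%:R * qz d.+1%:R^-1) * (p ^+ d * p * dz f)); first by ring.
by rewrite dq; ring.
Qed.

(** Differentiating the equality of powers shows that [f] and [g] have the same logarithmic
    derivative. Formulas with [powz] are checked through this lemma, after raising to the power
    [d]. *)
Lemma root_unique f g d : (0 < d)%N -> f 0%N = 1 -> g 0%N = 1 ->
  f ^+ d = g ^+ d -> f = g.
Proof.
case: d => // d _ f0 g0 fg; have dd := dz_derivation {poly rat}.
apply: (ode_unique f0 g0).
have dfg := etrans (esym (der_exp dd f d)) (etrans (congr1 _ fg) (der_exp dd g d)).
 have fU := unit_const1 f0; have gU := unit_const1 g0.
have dU : (d.+1%:R : zu_series) \is a GRing.unit.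
  rewrite fps_unitE coef_nat eqxx -(rmorph_nat polyC) rmorph_unit //.
  by rewrite unitfE pnatr_eq0.
have uU : d.+1%:R * f ^+ d \is a GRing.unit by rewrite unitrM dU unitrX.
apply: (can_inj (mulKr uU)).
transitivity ((d.+1%:R * f ^+ d * dz f) * g); first by ring.
rewrite dfg; transitivity (d.+1%:R * g ^+ d.+1 * dz g).
  by rewrite exprS; ring.
by rewrite -fg exprS; ring.
Qed.
End LogarithmAndPowers.

(** * The kernel method *)

Section MorphismsAndEvaluation.
Variables R S T : comNzRingType.

(** The first hypothesis is continuity of [theta], by which it passes through the infinite sum. *)
Lemma rmorph_evalf (phi : {rmorphism R -> fps S}) (theta : {rmorphism fps S -> fps T})
    (psi : {rmorphism R -> fps T}) (X : fps S) f :
  (forall N g, eqm N g 0 -> eqm N (theta g) 0) ->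
  (forall c, theta (phi c) = psi c) -> X 0%N = 0 ->
  theta (evalf phi X f) = evalf psi (theta X) f.
Proof.
move=> theta_cont theta_phi X0.
have tX0 : theta X 0%N = 0.
  by apply: (theta_cont 1%N) => // n; rewrite ltnS leqn0 => /eqP ->.
apply: eqm_eq => N.
have te : eqm N (theta (evalf phi X f)) (theta (\sum_(k < N) phi (f k) * X ^+ k)).
  have := @eqm_evalf _ _ phi X X0 N f; set g := \sum_(k < N) _ => eg.
  rewrite -[evalf _ _ _](subrK g) rmorphD -[X in eqm _ _ X]add0r.
  by apply: eqmD => //; apply: theta_cont => n nN /=; rewrite eg ?addrN.
apply: eqm_trans te _; apply: eqm_trans (eqm_sym (@eqm_evalf _ _ psi _ tX0 N f)).
rewrite rmorph_sum; apply: eqm_sum => k _.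
by rewrite rmorphM rmorphXn theta_phi.
Qed.

Lemma evalf_map (phi : {rmorphism S -> fps T}) (psi : {rmorphism R -> S})
    (chi : {rmorphism R -> fps T}) (X : fps T) f :
  (forall c, phi (psi c) = chi c) ->
  evalf phi X (map_fps psi f) = evalf chi X f.
Proof.
move=> pp; apply: fpsP => n; rewrite !coef_evalf.
by apply: eq_bigr => k _; rewrite /= pp.
Qed.
End MorphismsAndEvaluation.

Lemma evalf_id (R : comNzRingType) (f : fps R) : evalf (@fpsC R) (fpsX R) f = f.
Proof.
apply: fpsP => n; rewrite coef_evalf big_ord_recr big1 => [|i _].
  by rewrite coef_mulC coef_fpsXn eqxx mulr1; apply: add0r.
by rewrite coef_mulC coef_fpsXn eqn_leq leqNgt (ltn_ord i) mulr0.
Qed.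

Section Kernel.
Variables (K : comNzRingType) (q : {rmorphism rat -> K}) (u : K).

Let S := fps K.
Let A := fps S.

Definition qA : {rmorphism rat -> A} := (@fpsC S \o (@fpsC K \o q) : {rmorphism _ -> _}).
Definition qZ : {rmorphism rat -> fps K} := (@fpsC K \o q : {rmorphism _ -> _}).

(* At a node reached by k drivers, one parks if k > 0, and the node stays
   free, which u records, if k = 0. *)
Definition park_shift (f : S) : S :=
  Fps (fun n => f n.+1 + (if n == 0%N then u * f 0%N else 0)).

Definition shiftA (G : A) : A := Fps (fun n => park_shift (G n)).

Definition at_x0 : A -> fps K := map_fps (@const_coef K).
Definition const_x : fps K -> A := map_fps (@fpsC K).

Let x : A := fpsC (fpsX K).

(** Multiplication by [x] undoes the shift, except for the coefficient of x^0, where no driver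
    reaches the node: it is removed and comes back with the factor u x. *)
Lemma shiftA_eq G :
  x * shiftA G = G - const_x (at_x0 G) + fpsC (fpsC u) * x * const_x (at_x0 G).
Proof.
apply: fpsP => n; rewrite -mulrA.
transitivity (G n - fpsC (G n 0%N) + (fpsC (fpsC u) * (x * const_x (at_x0 G))) n) => //.
rewrite !coef_mulC; apply: fpsP => k.
transitivity (G n k - fpsC (G n 0%N) k
              + (fpsC u * (fpsX K * fpsC (G n 0%N))) k) => //.
rewrite coef_mulC !coef_mulX.
case: k => [|k]; first by rewrite subrr mulr0 addr0.
by rewrite /= subr0; case: k => //= k; rewrite mulr0.
Qed.

Variables (a E : fps rat) (H : A).
Hypothesis E0 : E 0%N = 1.

Let aA (G : A) := evalf qA G a.
Let EA : A := fpsC (map_fps q E).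

Hypothesis H_eq : H = fpsX S * shiftA (EA * aA H).

Let aZ (f : fps K) := evalf qZ f a.
Let a'Z (f : fps K) := evalf qZ f (dz a).
Let EZ (f : fps K) := evalf qZ f E.
Let E'Z (f : fps K) := evalf qZ f (dz E).
Let F := at_x0 H.

Lemma kernel_const0 : H 0%N = 0.
Proof. by rewrite H_eq coef_mulX. Qed.

Lemma at_x0_aH : at_x0 (EA * aA H) = aZ F.
Proof.
rewrite /at_x0 rmorphM /= (@rmorph_evalf _ _ _ qA (map_fps (@const_coef K)) qZ) ?kernel_const0 //.
- rewrite [X in X * _](_ : _ = 1) ?mul1r //.
  apply: fpsP => -[|n] /=; rewrite ?rmorph0 // /const_coef /= E0 rmorph1 //.
- by move=> N g g0 n nN; rewrite /= g0 ?rmorph0.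
by move=> c; apply: fpsP => -[|n] //=; rewrite rmorph0.
Qed.

Let Dx : A -> A := map_deriv (@dz K).

Lemma Dx_derivation : derivation Dx.
Proof.
have [dB dM _] := dz_derivation K.
exact: map_derivation.
Qed.

Lemma Dx_const_x f : Dx (const_x f) = 0.
Proof. by apply: fpsP => n; apply: fpsP => k; rewrite /= mul0rn. Qed.

Lemma Dx_fpsC s : Dx (fpsC s) = fpsC (dz s).
Proof.
by apply: fpsP => -[|n] //=; rewrite (der0 (dz_derivation K)).
Qed.

Lemma Dx_z : Dx (fpsX S) = 0.
Proof.
apply: fpsP => n; apply: fpsP => k /=; case: (n == 1%N).
  by rewrite mul0rn.
by rewrite mul0rn.
Qed.

Section AtX.
Variables (X : fps K) (X0 : X 0%N = 0).

Definition evS : {rmorphism S -> fps K} := ev (@fpsC K) X0.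

Let z0 : fpsX K 0%N = 0. Proof. by []. Qed.

(** This is the passage from G(z,x) to G(z,X(z)). *)
Definition evX : {rmorphism A -> fps K} := ev evS z0.

Lemma evX_const f : evX (const_x f) = f.
Proof.
rewrite [LHS](evalf_map (chi := @fpsC K)) ?evalf_id // => c.
exact: evalfC.
Qed.

Lemma evX_x : evX x = X.
Proof. by rewrite [LHS]evalfC // [LHS]evalfX. Qed.

Lemma evX_z : evX (fpsX S) = fpsX K.
Proof. exact: evalfX. Qed.

Lemma evX_series (e : fps rat) : evX (fpsC (map_fps q e)) = evalf qZ X e.
Proof. by rewrite [LHS]evalfC // [LHS](evalf_map (chi := qZ)). Qed.

Lemma evX_aA (e : fps rat) (G : A) : G 0%N = 0 ->
  evX (evalf qA G e) = evalf qZ (evX G) e.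
Proof.
move=> G0; apply: rmorph_evalf => //.
  by move=> N g g0; rewrite -(rmorph0 evX); apply: evalf_congr.
by move=> c; rewrite [LHS]evalfC // [LHS]evalfC.
Qed.
End AtX.

Lemma fpsX_inj (f g : fps K) : fpsX K * f = fpsX K * g -> f = g.
Proof.
move=> fg; apply: fpsP => n.
by rewrite -(coef_mulX f n.+1) fg coef_mulX.
Qed.

(** The values of [evX], written without a proof that [X] has constant coefficient 0, so that the
    operator whose fixed point is [X] is defined on all series. *)
Let ev2 (X : fps K) (G : A) : fps K :=
  Fps (fun n => \sum_(k < n.+1) (evalf (@fpsC K) X (G k) * fpsX K ^+ k) n).

Let ev2E (X : fps K) (X0 : X 0%N = 0) G : ev2 X G = evX X0 G.
Proof. by apply: fpsP => n; rewrite [RHS]coef_evalf. Qed.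

Lemma kernel_root_exists :
  exists2 X : fps K, X 0%N = 0 & X = fpsX K * (EZ X * a'Z (ev2 X H)).
Proof.
have [|X [X0 XE]] :=
    @fixpoint_exists K (fun X => fpsX K * (EZ X * a'Z (ev2 X H))); last by exists X.
split=> [f _|N f g _ _ fg]; first by rewrite coef_mulX.
apply: eqm_mulX; apply: eqmM; apply: eqm_evalf_arg => // n nN.
apply: eq_bigr => k _; apply: (eqmM (N := N)) => //.
exact: eqm_evalf_arg.
Qed.

Let regroup (B : comNzRingType) (v e b c d f w D : B) :
  v * (e * b + c * (d * D) + w * f) = v * (b * e + w * f) + v * (c * d) * D.
Proof. by ring. Qed.

Lemma kernel_method : exists X Y : fps K,
  [/\ X 0%N = 0, Y 0%N = 0, X = fpsX K * (EZ X * a'Z Y),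
      Y = fpsX K * (aZ Y * E'Z X + fpsC u * aZ F)
    & aZ F = aZ Y * (EZ X - X * E'Z X)].
Proof.
have [X X0 XE] := kernel_root_exists; rewrite (ev2E X0) in XE.
set Y := evX X0 H in XE; exists X, Y.
have Y0 : Y 0%N = 0 by rewrite /Y [LHS]evalf0 kernel_const0 rmorph0.
have u_ev : evX X0 (fpsC (fpsC u)) = fpsC u by rewrite [LHS]evalfC // [LHS]evalfC.
have H_kernel : x * H = fpsX S * (EA * aA H - const_x (aZ F)
    + fpsC (fpsC u) * x * const_x (aZ F)).
  by rewrite -at_x0_aH -shiftA_eq {1}H_eq mulrCA.
have eq1 : X * Y = fpsX K * (EZ X * aZ Y - aZ F + fpsC u * X * aZ F).
  have := congr1 (evX X0) H_kernel; rewrite !(rmorphM, rmorphD, rmorphN).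
  rewrite [evX X0 x]evX_x evX_z u_ev !evX_const.
  by rewrite evX_series (evX_aA X0 _ kernel_const0).
have eq2 : Y = fpsX K * (aZ Y * E'Z X + fpsC u * aZ F).
  have dD := Dx_derivation.
  have Dx_x : Dx x = 1.
    rewrite Dx_fpsC -[RHS](rmorph1 (@fpsC S)); congr fpsC; apply: fpsP => -[|n] //=.
    by rewrite mul0rn.
  have Dx_EA : Dx EA = fpsC (map_fps q (dz E)).
    rewrite Dx_fpsC; congr fpsC; apply: fpsP => n /=.
    by rewrite rmorphMn.
  have Dx_aA : Dx (aA H) = evalf qA H (dz a) * Dx H.
    apply: chain_rule => //; last exact: kernel_const0.
    move=> c; rewrite [qA c]/(fpsC (fpsC (q c))) Dx_fpsC.
    rewrite (_ : dz _ = 0) ?rmorph0 //.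
    by apply: fpsP => n; rewrite /= mul0rn.
  have := congr1 Dx H_kernel.
  rewrite !(der_mul dD) (der_add dD) (der_sub dD) !(der_mul dD) !Dx_const_x Dx_z.
  rewrite Dx_x Dx_EA Dx_aA Dx_fpsC (_ : dz (fpsC u) = 0); last first.
    by apply: fpsP => n; rewrite /= mul0rn.
  rewrite rmorph0 !(mul0r, mulr0, mul1r, mulr1, add0r, addr0, subr0).
  move/(congr1 (evX X0)); rewrite !(rmorphM, rmorphD, rmorphN).
  rewrite [evX X0 x]evX_x evX_z u_ev !evX_const.
  rewrite !evX_series !(evX_aA X0 _ kernel_const0) -/Y; set D := evX X0 (Dx H).
  rewrite -[evalf _ Y a]/(aZ Y) -[evalf _ X E]/(EZ X) -[evalf _ X _]/(E'Z X).
  rewrite -[evalf _ Y _]/(a'Z Y) => eqD.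
  (* The product rule yields [Y + X * D] on the left, [D] being dH/dx at [X]; by the equation of
     [X], the term in [D] on the right is [X * D] as well. *)
  apply: (addIr (X * D)); rewrite eqD.
  transitivity (fpsX K * (aZ Y * E'Z X + fpsC u * aZ F) + fpsX K * (EZ X * a'Z Y) * D).
    exact: regroup.
  by rewrite -XE.
split=> //; apply: fpsX_inj.
(* This is [eq1] with [Y] replaced by means of [eq2]; the terms in [u] agree on both sides. *)
have : fpsX K * (EZ X * aZ Y - aZ F + fpsC u * X * aZ F)
     = fpsX K * (X * (aZ Y * E'Z X + fpsC u * aZ F)) by rewrite -eq1 {1}eq2 mulrCA.
move/eqP; rewrite -subr_eq0 => /eqP eq3.
by apply/eqP; rewrite -subr_eq0 -oppr_eq0 -eq3; apply/eqP; ring.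
Qed.
End Kernel.

(** * The eight functional equations *)

Section Elimination.
Variables (B : comUnitRingType) (z u X Y e e' D : B).

(** The case where [a] is a power of 1/(1 - y), with [D] standing for the exponent. [G - 1 = G * Y]
    supplies the power of [G] with which the equation of [X] absorbs [z]; what remains is linear in
    [G]. *)
Lemma eliminate_geo G d : G * (1 - Y) = 1 ->
  X = z * (e * (D * G ^+ d.+1)) ->
  Y = z * (G ^+ d * e' + u * (G ^+ d * (e - X * e'))) ->
  D * (G - 1) * e = X * (e' + u * (e - X * e')).
Proof.
move=> HG HX HY; have -> : G - 1 = G * Y by rewrite -HG; ring.
rewrite {1}HY; set k := e - X * e'.
transitivity (z * (e * (D * G ^+ d.+1)) * (e' + u * k)); last by rewrite -HX.
by rewrite exprS; ring.
Qed.

(** The case where [a] is a power of 1 + y. A factor [V] survives on the right, so the result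
    determines the inverse of [V]: hence the denominators in the d-ary formulas. *)
Lemma eliminate_pow V d : V = 1 + Y ->
  X = z * (e * (D * V ^+ d)) ->
  Y = z * (V ^+ d.+1 * e' + u * (V ^+ d.+1 * (e - X * e'))) ->
  D * (V - 1) * e = V * (X * (e' + u * (e - X * e'))).
Proof.
move=> HV HX HY; have -> : V - 1 = Y by rewrite HV; ring.
rewrite {1}HY; set k := e - X * e'.
transitivity (V * (z * (e * (D * V ^+ d)) * (e' + u * k))); last by rewrite -HX.
by rewrite exprS; ring.
Qed.

Lemma eliminate_exp W :
  X = z * (e * W) ->
  Y = z * (W * e' + u * (W * (e - X * e'))) ->
  Y * e = X * (e' + u * (e - X * e')).
Proof.
move=> HX HY; rewrite {1}HY; set k := e - X * e'.
transitivity (z * (e * W) * (e' + u * k)); last by rewrite -HX.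
by ring.
Qed.

(** For functions E is its own derivative, so [e' = e], and this unit will cancel from the
    eliminated equation. *)
Lemma eliminate_functions :
  X * (e + u * (e - X * e)) = (X + u * X * (1 - X)) * e.
Proof. by ring. Qed.

(* The substitution Q = X / (1 - X). *)
Lemma eliminate_distributions (Q : B) : e * (1 - X) = 1 -> Q = X * e ->
  [/\ e = 1 + Q, e - X * (e * e) = (1 + Q) * (1 - Q)
    & X * (e * e + u * (e - X * (e * e)))
      = (Q + u * Q * (1 - Q) / (1 + Q)) * e].
Proof.
move=> He HQ; have eE : e = 1 + Q by rewrite HQ -[X in X + _]He; ring.
have eU : e \is a GRing.unit by apply/unitrPr; exists (1 - X).
have kE : e - X * (e * e) = (1 + Q) * (1 - Q).
  by rewrite mulrA -HQ -eE; ring.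
split=> //; rewrite kE -eE mulrDl (divrK eU).
have -> : X * (e * e + u * (e * (1 - Q))) = (X * e) * e + u * (X * e) * (1 - Q).
  by ring.
by rewrite -HQ.
Qed.
End Elimination.

Lemma expS_congr N f g : eqm N f g -> eqm N (expS f) (expS g).
Proof. by rewrite !expSE; apply: expz_congr. Qed.

Ltac eqm_tac :=
  lazymatch goal with
  | |- eqm _ ?f ?f => exact: eqm_refl
  | |- eqm _ (_ + _) (_ + _) => apply: eqmD; eqm_tac
  | |- eqm _ (- _) (- _) => apply: eqmN; eqm_tac
  | |- eqm _ (_ * _) (_ * _) => apply: eqmM; eqm_tac
  | |- eqm _ (_ ^+ _) (_ ^+ _) => apply: eqmX; eqm_tac
  | |- eqm _ (_ ^-1) (_ ^-1) => apply: eqmV; eqm_tac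
  | |- eqm _ (expS _) (expS _) => apply: expS_congr; eqm_tac
  | _ => assumption
  end.

Section Cases.

Let z := zvar.
Let u := uvar.

Definition geo_series : fps rat := Fps (fun=> 1).
Definition geoz (f : zu_series) : zu_series := evalf qz f geo_series.

Lemma geo_seriesK : (1 - fpsX _) * geo_series = 1.
Proof.
rewrite mulrBl mul1r; apply: fpsP => n.
transitivity (1 - (fpsX _ * geo_series) n) => //.
by rewrite coef_mulX; case: n => [|n]; rewrite ?subr0 // subrr.
Qed.

Lemma dz_fpsX (R : comNzRingType) : dz (fpsX R) = 1.
Proof. by apply: fpsP => -[|n] //=; rewrite mul0rn. Qed.

Lemma dz_geo_series : dz geo_series = geo_series * geo_series.
Proof.
have dd := dz_derivation rat; have := congr1 (@dz _) geo_seriesK.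
rewrite (der_mul dd) (der_sub dd) (der1 dd) dz_fpsX sub0r mulN1r => /eqP.
rewrite addrC subr_eq0 => /eqP H.
by rewrite -[LHS]mul1r -geo_seriesK mulrAC H.
Qed.

Lemma geo_series0 : geo_series 0%N = 1. Proof. by []. Qed.

Lemma exp_series0 : exp_series 0%N = 1.
Proof. by rewrite /= fact0 invr1. Qed.

Lemma geozK (f : zu_series) : f 0%N = 0 -> geoz f * (1 - f) = 1.
Proof.
move=> f0; rewrite /geoz mulrC -{1}(evalfX qz f0) -(evalf1 qz f0).
by rewrite -(evalfB qz f0) -(evalfM qz f0) geo_seriesK.
Qed.

Lemma geoz_coef0 f : geoz f 0%N = 1.
Proof. by rewrite /geoz evalf0 /=. Qed.

Lemma natz_unit d : (0 < d)%N -> (d%:R : zu_series) \is a GRing.unit.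
Proof.
case: d => // d _.
rewrite fps_unitE coef_nat eqxx -(rmorph_nat polyC) rmorph_unit //.
by rewrite unitfE pnatr_eq0.
Qed.

(** The interface between the two halves of the proof: counting provides such an [H], and each of
    the eight formulas follows from its existence. *)
Definition tree_gf (a E : fps rat) (F : zu_series) :=
  exists2 H : fps (fps {poly rat}),
    H = fpsX _ * shiftA 'X (fpsC (map_fps polyC E) * evalf (qA polyC) H a)
  & F = at_x0 H.

Lemma tree_gf_kernel (a E : fps rat) (F : zu_series) : E 0%N = 1 -> tree_gf a E F ->
  F 0%N = 0 /\ exists X Y : zu_series,
  [/\ X 0%N = 0, Y 0%N = 0,
      X = z * (evalf qz X E * evalf qz Y (dz a)),
      Y = z * (evalf qz Y a * evalf qz X (dz E)
               + u * (evalf qz Y a * (evalf qz X E - X * evalf qz X (dz E))))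
    & evalf qz F a = evalf qz Y a * (evalf qz X E - X * evalf qz X (dz E))].
Proof.
move=> E0 [H HE ->]; split.
  by rewrite /at_x0 /= (kernel_const0 HE).
have [X [Y [X0 Y0 XE YE FE]]] := kernel_method E0 HE.
exists X, Y; split=> //.
by rewrite {1}YE; congr (_ * (_ + _ * _)).
Qed.

Lemma given_byI (F : zu_series) (G Phi : zu_series -> zu_series) (Q : zu_series) :
  contracting Phi -> Q 0%N = 0 -> Q = Phi Q -> F = G Q -> given_by F G Phi.
Proof.
move=> cP Q0 QE FE; exists Q; split=> //; split=> // P [P0 PE].
exact: (fixpoint_unique cP).
Qed.

Lemma contractingX (Phi R : zu_series -> zu_series) :
  (forall f, Phi f = z * R f) ->
  (forall N f g, eqm N f g -> eqm N (R f) (R g)) -> contracting Phi.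
Proof.
move=> PhiE Rc; split=> [f _|N f g _ _ fg]; rewrite ?PhiE ?coef_mulX //.
by apply: eqm_mulX; apply: Rc.
Qed.

Lemma geoz_inv (F : zu_series) : F 0%N = 0 -> F = 1 - (geoz F)^-1.
Proof.
move=> F0; have GK := geozK F0.
have GU : geoz F \is a GRing.unit by apply/unit_const1/geoz_coef0.
apply: (mulrI GU); rewrite mulrBr mulr1 (mulrV GU) -GK; ring.
Qed.

Lemma eval_geo_exp (Y : zu_series) d : Y 0%N = 0 ->
  evalf qz Y (geo_series ^+ d) = geoz Y ^+ d.
Proof. by move=> Y0; rewrite (evalf_exp qz Y0). Qed.

Lemma eval_dz_geo_exp (Y : zu_series) d : (0 < d)%N -> Y 0%N = 0 ->
  evalf qz Y (dz (geo_series ^+ d)) = d%:R * geoz Y ^+ d.+1.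
Proof.
case: d => // d _ Y0; rewrite (der_exp (dz_derivation _)) dz_geo_series.
rewrite !(evalfM qz Y0) (evalf_nat qz Y0) (evalf_exp qz Y0) -/(geoz Y).
by rewrite !exprS; ring.
Qed.

Lemma eval_pow_exp (Y : zu_series) d : Y 0%N = 0 ->
  evalf qz Y ((1 + fpsX _) ^+ d) = (1 + Y) ^+ d.
Proof.
by move=> Y0; rewrite (evalf_exp qz Y0) (evalfD qz Y0) (evalf1 qz Y0) (evalfX qz Y0).
Qed.

Lemma eval_dz_pow_exp (Y : zu_series) d : Y 0%N = 0 ->
  evalf qz Y (dz ((1 + fpsX _) ^+ d.+1)) = d.+1%:R * (1 + Y) ^+ d.
Proof.
move=> Y0; have dd := dz_derivation rat.
rewrite (der_exp dd) (der_add dd) (der1 dd) dz_fpsX add0r mulr1.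
by rewrite (evalfM qz Y0) (evalf_nat qz Y0) eval_pow_exp.
Qed.

Lemma eval_dz_geo (X : zu_series) : X 0%N = 0 ->
  evalf qz X (dz geo_series) = geoz X * geoz X.
Proof. by move=> X0; rewrite dz_geo_series (evalfM qz X0). Qed.

Lemma coef0_sub (f g : zu_series) : (f - g) 0%N = f 0%N - g 0%N.
Proof. by []. Qed.

Lemma coef0_add (f g : zu_series) : (f + g) 0%N = f 0%N + g 0%N.
Proof. by []. Qed.

Lemma coef0_one : (1 : zu_series) 0%N = 1. Proof. by []. Qed.

Definition coefs0E := (coef0_sub, coef0_add, @coef_mul0 {poly rat}, coef0_one,
  @coef_exp0 {poly rat}).

(** Ordered trees behave as bundled trees with d = 1, whence the exponent [^+ 1]; here [Q] is
    [X]. *)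
Lemma ordered_functions F :
  tree_gf (geo_series ^+ 1) exp_series F ->
  given_by F
     (fun Q => 1 - ((1 - Q) * (1 + Q + u * Q * (1 - Q)) * expS Q)^-1)
     (fun Q => z * (1 + Q + u * Q * (1 - Q)) ^+ 2 * expS Q).
Proof.
move=> /(tree_gf_kernel exp_series0)[F0 [X [Y [X0 Y0 XE YE FE]]]].
rewrite dz_exp_series -/(expz X) !(eval_geo_exp 1) // (eval_dz_geo_exp _ Y0) //
  in XE YE FE.
set G := geoz Y in XE YE FE; set e := expz X in XE YE FE.
have := eliminate_geo (geozK Y0) XE YE.
rewrite eliminate_functions => /(mulIr (expz_unit X)) el.
have GE : G = 1 + X + u * X * (1 - X).
  by transitivity (1 + 1%:R * (G - 1)); [ring | rewrite el; ring].
apply: (@given_byI _ _ _ X _ X0).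
- apply: (@contractingX _ (fun f => (1 + f + u * f * (1 - f)) ^+ 2 * expS f)).
    by move=> f; rewrite mulrA.
  by move=> N f g fg; eqm_tac.
- by rewrite -GE expSE -/e {1}XE; ring.
- rewrite -GE expSE {1}(geoz_inv F0); congr (1 - _^-1).
  by rewrite -[LHS]expr1 FE -/e; ring.
Qed.

Lemma unordered_functions F :
  tree_gf exp_series exp_series F ->
  given_by F
     (fun Q => lnS (1 - Q) + Q * (2%:R + u * (1 - Q)))
     (fun Q => z * expS (Q * (2%:R + u * (1 - Q)))).
Proof.
move=> /(tree_gf_kernel exp_series0)[F0 [X [Y [X0 Y0 XE YE FE]]]].
rewrite dz_exp_series -!/(expz _) in XE YE FE.
set W := expz Y in XE YE FE; set e := expz X in XE YE FE.
have := eliminate_exp XE YE.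
rewrite eliminate_functions => /(mulIr (expz_unit X)) YQ.
have XY : X * (2%:R + u * (1 - X)) = X + Y by rewrite YQ; ring.
have XY0 : (X + Y) 0%N = 0 by rewrite coef0_add X0 Y0 addr0.
apply: (@given_byI _ _ _ X _ X0).
- apply: (@contractingX _ (fun f => expS (f * (2%:R + u * (1 - f))))).
    by move=> f.
  by move=> N f g fg; eqm_tac.
- by rewrite XY expSE (expz_D X0 Y0) -/e -/W.
- have c0 : (1 - X) 0%N = 1 by rewrite !coefs0E X0 subr0.
  (* The exponential of [F] is [W * (e - X * e)], that is, (1 - X) exp(X + Y). *)
  rewrite XY lnSE; apply: expz_inj => //.
    by rewrite coef0_add lnz_coef0 XY0 addr0.
  rewrite (expz_D (lnz_coef0 _) XY0) (expz_lnz c0) (expz_D X0 Y0) FE -/e -/W.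
  by ring.
Qed.

Lemma d_ary_functions d F : (0 < d)%N ->
  tree_gf ((1 + fpsX _) ^+ d) exp_series F ->
  given_by F
     (fun Q => powS (1 - d%:R * Q) (d%:R^-1) * expS Q
               / (1 - Q - u * Q * (1 - d%:R * Q)) - 1)
     (fun Q => z * expS (d%:R * Q)
               / (1 - Q - u * Q * (1 - d%:R * Q)) ^+ (d - 1)).
Proof.
case: d => // d d_gt0 /(tree_gf_kernel exp_series0)[F0 [X [Y [X0 Y0 XE YE FE]]]].
rewrite dz_exp_series -/(expz X) !(eval_pow_exp d.+1) // (eval_dz_pow_exp d Y0)
  in XE YE FE.
set V := 1 + Y in XE YE FE; set e := expz X in XE YE FE.
have DU := natz_unit d_gt0; set D := d.+1%:R in DU XE *.
have := eliminate_pow (erefl V) XE YE.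
rewrite eliminate_functions mulrA => /(mulIr (expz_unit X)) el.
(* Dividing [X] by the arity removes the factor [D] that a' brings into its equation. *)
have [Q DQ] : exists Q, D * Q = X by exists (D^-1 * X); rewrite (mulVKr DU).
have Q0 : Q 0%N = 0.
  have Q_E : Q = D^-1 * X by rewrite -DQ (mulKr DU).
  by rewrite Q_E coef_mul0 X0 mulr0.
have VE : (1 - Q - u * Q * (1 - D * Q)) * V = 1.
  apply: (mulrI DU); rewrite mulr1.
  transitivity (D * (V - 1) - V * (D * Q + u * (D * Q) * (1 - D * Q)) + D).
    by ring.
  by rewrite el -DQ; ring.
have V0 : V 0%N = 1 by rewrite coef0_add Y0 addr0.
set w := 1 - Q - _ in VE *.
have wV : w^-1 = V.
  have wU : w \is a GRing.unit by apply/unitrPr; exists V.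
  by apply: (mulrI wU); rewrite (mulrV wU).
apply: (@given_byI _ _ _ Q _ Q0).
- apply: (@contractingX _ (fun f => expS (D * f)
               / (1 - f - u * f * (1 - D * f)) ^+ (d.+1 - 1))).
    by move=> f; rewrite mulrA.
  by move=> N f g fg; eqm_tac.
- rewrite -/w -exprVn wV DQ expSE -/e subn1; apply: (mulrI DU).
  by rewrite DQ {1}XE; ring.
- rewrite -/w wV expSE powSE; apply/eqP; rewrite -subr_eq opprK addrC; apply/eqP.
  have c0 : (1 - D * Q) 0%N = 1 by rewrite !coefs0E Q0 mulr0 subr0.
  (* The [D]-th power of 1 + F is that of [V] times e^X (1 - X), and e^X is the [D]-th power of e^Q
     because [X = D * Q]. *)
  apply: (root_unique d_gt0); first by rewrite coef0_add F0 addr0.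
    by rewrite !coef_mul0 powz_coef0 expz_coef0 V0 !mulr1.
  rewrite !exprMn (powz_root d_gt0 c0) FE -(expz_nat d.+1 Q0).
  by rewrite -/D DQ -/e; ring.
Qed.

Lemma bundled_functions d F : (0 < d)%N ->
  tree_gf (geo_series ^+ d) exp_series F ->
  given_by F
     (fun Q => 1 - (powS (1 - d%:R * Q) (d%:R^-1)
                    * (1 + Q + u * Q * (1 - d%:R * Q)) * expS Q)^-1)
     (fun Q => z * (1 + Q + u * Q * (1 - d%:R * Q)) ^+ (d + 1)
               * expS (d%:R * Q)).
Proof.
move=> d_gt0 /(tree_gf_kernel exp_series0)[F0 [X [Y [X0 Y0 XE YE FE]]]].
rewrite dz_exp_series -/(expz X) !(eval_geo_exp d) // (eval_dz_geo_exp d_gt0 Y0)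
  in XE YE FE.
set G := geoz Y in XE YE FE; set e := expz X in XE YE FE.
have DU := natz_unit d_gt0; set D := d%:R in DU XE *.
have := eliminate_geo (geozK Y0) XE YE.
rewrite eliminate_functions => /(mulIr (expz_unit X)) el.
have [Q DQ] : exists Q, D * Q = X by exists (D^-1 * X); rewrite (mulVKr DU).
have Q0 : Q 0%N = 0.
  have Q_E : Q = D^-1 * X by rewrite -DQ (mulKr DU).
  by rewrite Q_E coef_mul0 X0 mulr0.
have GE : G = 1 + Q + u * Q * (1 - D * Q).
  apply: (mulrI DU); transitivity (D + D * (G - 1)); first by ring.
  by rewrite el -DQ; ring.
apply: (@given_byI _ _ _ Q _ Q0).
- apply: (@contractingX _ (fun f =>
    (1 + f + u * f * (1 - D * f)) ^+ (d + 1) * expS (D * f))).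
    by move=> f; rewrite mulrA.
  by move=> N f g fg; eqm_tac.
- rewrite -GE DQ expSE -/e; apply: (mulrI DU); rewrite DQ {1}XE addn1; ring.
- rewrite -GE expSE powSE {1}(geoz_inv F0); congr (1 - _^-1).
  have c0 : (1 - D * Q) 0%N = 1 by rewrite !coefs0E Q0 mulr0 subr0.
  apply: (root_unique d_gt0); first exact: geoz_coef0.
    by rewrite !coefs0E powz_coef0 expz_coef0 geoz_coef0 !mulr1.
  rewrite !exprMn (powz_root d_gt0 c0) FE -(expz_nat d Q0).
  by rewrite -/D DQ -/e; ring.
Qed.

(* With Q = X / (1 - X), the factor 1 + Q is 1 / (1 - X). *)
Lemma distribution_kernel (X : zu_series) : X 0%N = 0 ->
  exists Q : zu_series,
  [/\ Q 0%N = 0, Q = X * geoz X, geoz X = 1 + Q,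
      geoz X - X * (geoz X * geoz X) = (1 + Q) * (1 - Q)
    & X * (geoz X * geoz X + u * (geoz X - X * (geoz X * geoz X)))
      = (Q + u * Q * (1 - Q) / (1 + Q)) * geoz X].
Proof.
move=> X0; exists (X * geoz X).
have [eE kE elE] := eliminate_distributions u (geozK X0) (erefl (X * geoz X)).
by split=> //; rewrite coef_mul0 X0 mul0r.
Qed.

Lemma geoz_unit (f : zu_series) : geoz f \is a GRing.unit.
Proof. exact/unit_const1/geoz_coef0. Qed.

Lemma ordered_distributions F :
  tree_gf (geo_series ^+ 1) geo_series F ->
  given_by F
     (fun Q => 1 - ((1 - Q) * ((1 + Q) ^+ 2 + u * Q * (1 - Q)))^-1)
     (fun Q => z * ((1 + Q) ^+ 2 + u * Q * (1 - Q)) ^+ 2).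
Proof.
move=> /(tree_gf_kernel geo_series0)[F0 [X [Y [X0 Y0 XE YE FE]]]].
rewrite (eval_dz_geo X0) -/(geoz X) !(eval_geo_exp 1) // (eval_dz_geo_exp _ Y0) //
  in XE YE FE.
have [Q [Q0 QX eE kE elE]] := distribution_kernel X0.
set G := geoz Y in XE YE FE; have eU := geoz_unit X.
set e := geoz X in XE YE FE QX eE kE elE eU.
have := eliminate_geo (geozK Y0) XE YE.
rewrite elE => /(mulIr eU) el.
have GE : (1 + Q) * G = (1 + Q) ^+ 2 + u * Q * (1 - Q).
  transitivity ((1 + Q) + (1 + Q) * (1%:R * (G - 1))); first by ring.
  rewrite el; rewrite eE in eU.
  transitivity ((1 + Q) + (1 + Q) * Q + u * Q * (1 - Q) * ((1 + Q) / (1 + Q))).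
    by ring.
  by rewrite (divrr eU); ring.
apply: (@given_byI _ _ _ Q _ Q0).
- apply: (@contractingX _ (fun f => ((1 + f) ^+ 2 + u * f * (1 - f)) ^+ 2)).
    by move=> f.
  by move=> N f g fg; eqm_tac.
(* The factor [e = 1 + Q] occurs twice, in [Q = X * e] and in the equation of [X]; both go into the
   square of [(1 + Q) * G]. *)
- by rewrite -GE {1}QX {1}XE eE; ring.
- rewrite -GE {1}(geoz_inv F0); congr (1 - _^-1).
  by rewrite -[LHS]expr1 FE kE; ring.
Qed.

Lemma unordered_distributions F :
  tree_gf exp_series geo_series F ->
  given_by F
     (fun Q => Q + lnS (1 + Q) + lnS (1 - Q) + u * Q * (1 - Q) / (1 + Q))
     (fun Q => z * (1 + Q) ^+ 2 * expS (Q * (1 + u * (1 - Q) / (1 + Q)))).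
Proof.
move=> /(tree_gf_kernel geo_series0)[F0 [X [Y [X0 Y0 XE YE FE]]]].
rewrite (eval_dz_geo X0) -/(geoz X) dz_exp_series -!/(expz _) in XE YE FE.
have [Q [Q0 QX eE kE elE]] := distribution_kernel X0.
set W := expz Y in XE YE FE; have eU := geoz_unit X.
set e := geoz X in XE YE FE QX eE kE elE eU.
have := eliminate_exp XE YE; rewrite elE => /(mulIr eU) YQ.
apply: (@given_byI _ _ _ Q _ Q0).
- apply: (@contractingX _ (fun f => (1 + f) ^+ 2
     * expS (f * (1 + u * (1 - f) / (1 + f))))).
    by move=> f; rewrite mulrA.
  by move=> N f g fg; eqm_tac.
- have -> : Q * (1 + u * (1 - Q) / (1 + Q)) = Y by rewrite YQ; ring.
  by rewrite expSE -/W -eE {1}QX {1}XE; ring.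
- have cp : (1 + Q) 0%N = 1 by rewrite coef0_add Q0 addr0.
  have cm : (1 - Q) 0%N = 1 by rewrite coef0_sub Q0 subr0.
  rewrite (lnSE (1 + Q)) (lnSE (1 - Q)).
  transitivity (Y + (lnz (1 + Q) + lnz (1 - Q))); last by rewrite YQ; ring.
  have ln0 : (lnz (1 + Q) + lnz (1 - Q)) 0%N = 0.
    by rewrite coef0_add !lnz_coef0 addr0.
  apply: expz_inj => //.
    by rewrite coef0_add ln0 Y0 addr0.
  rewrite (expz_D Y0 ln0) (expz_D (lnz_coef0 _) (lnz_coef0 _)).
  by rewrite (expz_lnz cp) (expz_lnz cm) FE kE.
Qed.

Lemma d_ary_distributions d F : (0 < d)%N ->
  tree_gf ((1 + fpsX _) ^+ d) geo_series F ->
  given_by F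
     (fun Q => powS (1 + Q) (d%:R^-1) * powS (1 - Q) (d%:R^-1)
               / (1 - Q / d%:R - u * Q * (1 - Q) / (d%:R * (1 + Q))) - 1)
     (fun Q => d%:R * z * (1 + Q) ^+ 2
               / (1 - Q / d%:R - u * Q * (1 - Q) / (d%:R * (1 + Q)))
                 ^+ (d - 1)).
Proof.
case: d => // d d_gt0 /(tree_gf_kernel geo_series0)[F0 [X [Y [X0 Y0 XE YE FE]]]].
rewrite (eval_dz_geo X0) -/(geoz X) !(eval_pow_exp d.+1) // (eval_dz_pow_exp d Y0)
  in XE YE FE.
have [Q [Q0 QX eE kE elE]] := distribution_kernel X0.
set V := 1 + Y in XE YE FE; have eU := geoz_unit X.
set e := geoz X in XE YE FE QX eE kE elE eU.
have DU := natz_unit d_gt0; set D := d.+1%:R in DU XE *.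
have := eliminate_pow (erefl V) XE YE.
rewrite elE mulrA => /(mulIr eU) el.
have e'U : (1 + Q) \is a GRing.unit by rewrite -eE.
set w := 1 - Q / D - u * Q * (1 - Q) / (D * (1 + Q)).
have VE : w * V = 1.
  apply: (mulrI DU); rewrite mulr1 /w (invrM DU e'U).
  transitivity (D * (V - 1) + D - D / D * (V * (Q + u * Q * (1 - Q) / (1 + Q)))).
    by ring.
  by rewrite el (divrr DU); ring.
have V0 : V 0%N = 1 by rewrite coef0_add Y0 addr0.
have wV : w^-1 = V.
  have wU : w \is a GRing.unit by apply/unitrPr; exists V.
  by apply: (mulrI wU); rewrite (mulrV wU).
apply: (@given_byI _ _ _ Q _ Q0).
- apply: (@contractingX _ (fun f => D * (1 + f) ^+ 2
   / (1 - f / D - u * f * (1 - f) / (D * (1 + f))) ^+ (d.+1 - 1))).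
    by move=> f; rewrite !mulrA [D * z]mulrC.
  by move=> N f g fg; eqm_tac.
(* Here [Q = X * e] is not divided by the arity, so the factor [D] of a' remains in the equation of
   [Q]. *)
- by rewrite -/w -exprVn wV -eE subn1 {1}QX {1}XE; ring.
- rewrite -/w wV !powSE; apply/eqP; rewrite -subr_eq opprK addrC; apply/eqP.
  have cp : (1 + Q) 0%N = 1 by rewrite coef0_add Q0 addr0.
  have cm : (1 - Q) 0%N = 1 by rewrite coef0_sub Q0 subr0.
  apply: (root_unique d_gt0); first by rewrite coef0_add F0 addr0.
    by rewrite !coef_mul0 !powz_coef0 V0 !mulr1.
  rewrite !exprMn (powz_root d_gt0 cp) (powz_root d_gt0 cm) FE kE.
  by ring.
Qed.

Lemma bundled_distributions d F : (0 < d)%N ->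
  tree_gf (geo_series ^+ d) geo_series F ->
  given_by F
     (fun Q => 1 - (powS (1 + Q) (d%:R^-1) * powS (1 - Q) (d%:R^-1)
                    * (1 + Q / d%:R
                       + u * Q * (1 - Q) / (d%:R * (1 + Q))))^-1)
     (fun Q => d%:R * z * (1 + Q) ^+ 2
               * (1 + Q / d%:R + u * Q * (1 - Q) / (d%:R * (1 + Q)))
                 ^+ (d + 1)).
Proof.
move=> d_gt0 /(tree_gf_kernel geo_series0)[F0 [X [Y [X0 Y0 XE YE FE]]]].
rewrite (eval_dz_geo X0) -/(geoz X) !(eval_geo_exp d) // (eval_dz_geo_exp d_gt0 Y0)
  in XE YE FE.
have [Q [Q0 QX eE kE elE]] := distribution_kernel X0.
have G0 : geoz Y 0%N = 1 by apply: geoz_coef0.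
set G := geoz Y in XE YE FE G0; have eU := geoz_unit X.
set e := geoz X in XE YE FE QX eE kE elE eU.
have DU := natz_unit d_gt0; set D := d%:R in DU XE *.
have := eliminate_geo (geozK Y0) XE YE; rewrite elE => /(mulIr eU) el.
have e'U : (1 + Q) \is a GRing.unit by rewrite -eE.
have GE : G = 1 + Q / D + u * Q * (1 - Q) / (D * (1 + Q)).
  transitivity (1 + D^-1 * (D * (G - 1))); first by rewrite (mulKr DU); ring.
  by rewrite el (invrM DU e'U); ring.
apply: (@given_byI _ _ _ Q _ Q0).
- apply: (@contractingX _ (fun f => D * (1 + f) ^+ 2
   * (1 + f / D + u * f * (1 - f) / (D * (1 + f))) ^+ (d + 1))).
    by move=> f; rewrite !mulrA [D * z]mulrC.
  by move=> N f g fg; eqm_tac.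
- by rewrite -GE -eE addn1 {1}QX {1}XE; ring.
- rewrite -GE !powSE {1}(geoz_inv F0); congr (1 - _^-1).
  have cp : (1 + Q) 0%N = 1 by rewrite coef0_add Q0 addr0.
  have cm : (1 - Q) 0%N = 1 by rewrite coef0_sub Q0 subr0.
  apply: (root_unique d_gt0); first exact: geoz_coef0.
    by rewrite !coef_mul0 !powz_coef0 G0 !mulr1.
  rewrite !exprMn (powz_root d_gt0 cp) (powz_root d_gt0 cm).
  by rewrite FE kE; ring.
Qed.
End Cases.

(** * Plane forests *)

(* A plane forest is encoded as a binary tree: [Bin l r] is the forest whose
   first tree has l as the forest of subtrees of its root, and whose other trees
   form r. *)
Inductive forest := Leaf | Bin of forest & forest.

HB.instance Definition _ := gen_eqMixin forest.

Fixpoint nodes s := if s is Bin l r then (nodes l + nodes r).+1 else 0%N.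
Fixpoint nroots s := if s is Bin _ r then (nroots r).+1 else 0%N.
Fixpoint height s := if s is Bin l r then (maxn (height l) (height r)).+1 else 0%N.

Fixpoint forests h :=
  if h is h'.+1 then Leaf :: [seq Bin l r | l <- forests h', r <- forests h']
  else [:: Leaf].

Lemma height_nodes s : (height s <= nodes s)%N.
Proof. by elim: s => //= l IHl r IHr; lia. Qed.

Lemma nroots_nodes s : (nroots s <= nodes s)%N.
Proof. by elim: s => //= l IHl r IHr; lia. Qed.

Lemma mem_forests h s : (s \in forests h) = (height s <= h)%N.
Proof.
have LB l r : (Bin l r == Leaf) = false by apply/eqP.
elim: h s => [|h IHh] [|l r]; rewrite ?inE ?eqxx ?LB //= ltnS geq_max -!IHh.
apply/allpairsP/andP => [[[l' r'] /= [hl hr [-> ->]]] //|[hl hr]].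
by exists (l, r).
Qed.

Lemma forests_uniq h : uniq (forests h).
Proof.
elim: h => //= h IHh; apply/andP; split.
  by apply/allpairsP => -[[l r] [_ _]].
by apply: allpairs_uniq => // -[l r] [l' r'] _ _ /= [-> ->].
Qed.

Section ForestSums.
Variables (V : nmodType) (f : forest -> V).

(** The height is at most the number of nodes, so [forests n] already contains every forest with [n]
    nodes. *)
Lemma sum_forests_stable (P : pred forest) h n : (n <= h)%N ->
  \sum_(s <- forests h | P s && (nodes s == n)) f s
  = \sum_(s <- forests n | P s && (nodes s == n)) f s.
Proof.
move=> nh; rewrite -[LHS]big_filter -[RHS]big_filter; apply: perm_big; apply: uniq_perm.
- by rewrite filter_uniq ?forests_uniq.
- by rewrite filter_uniq ?forests_uniq.
move=> s; rewrite !mem_filter !mem_forests.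
case: (boolP (P s && _)) => //= /andP[_ /eqP ns].
by have := height_nodes s; lia.
Qed.
End ForestSums.

Section ForestSeries.
Variables (K : comNzRingType) (q : {rmorphism rat -> K}) (u : K) (a : fps rat).

Local Notation S := (fps K).

Lemma park_shift_is_zmod_morphism : zmod_morphism (@park_shift K u).
Proof.
move=> f g; apply: fpsP => n.
transitivity ((f n.+1 - g n.+1) + (if n == 0%N then u * (f 0%N - g 0%N) else 0)) => //.
transitivity ((f n.+1 + (if n == 0%N then u * f 0%N else 0))
  - (g n.+1 + (if n == 0%N then u * g 0%N else 0))) => //.
by case: (n == 0%N); ring.
Qed.

HB.instance Definition _ :=
  GRing.isZmodMorphism.Build S S (@park_shift K u) park_shift_is_zmod_morphism.

(** A series in [x], whose exponent records the drivers leaving the forest. The root of the first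
    tree contributes [a] for its number of children, [E] for the drivers who prefer it and
    [park_shift] for the one who parks there. *)
Fixpoint weight (E : S) s : S :=
  if s is Bin l r then
    park_shift u (fpsC (q (a (nroots l))) * (E * weight E l)) * weight E r
  else 1.

Section TreeSeries.
Variable E : fps rat.
Let EK : S := map_fps q E.
Let W := weight EK.

Definition forest_series k : fps S :=
  Fps (fun n => \sum_(s <- forests n | (nroots s == k) && (nodes s == n)) W s).

Lemma forest_series0 : forest_series 0 = 1.
Proof.
apply: fpsP => n; rewrite /forest_series [LHS]/=.
have -> : \sum_(s <- forests n | (nroots s == 0) && (nodes s == n)) W s
    = \sum_(s <- forests n | s == Leaf) (if n == 0%N then W s else 0).
  rewrite big_mkcond [RHS]big_mkcond; apply: eq_bigr => -[|l r] _ /=.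
    by rewrite eqxx eq_sym.
  by case: eqP.
rewrite -big_filter (perm_big [:: Leaf]) /= ?big_seq1 //.
apply: uniq_perm => //; first by rewrite filter_uniq ?forests_uniq.
move=> s; rewrite mem_filter mem_forests inE.
by case: eqP => [->|].
Qed.

Let aG : fps S :=
  Fps (fun n => \sum_(k < n.+1) fpsC (q (a k)) * forest_series k n).

(** The first tree is cut off: a root above the forest [l], followed by the forest [r]. The series
    [aG] becomes a(H) once [forest_series k] is known to be the k-th power of H. *)
Lemma forest_seriesS k :
  forest_series k.+1
  = fpsX S * (shiftA u (fpsC EK * aG) * forest_series k).
Proof.
apply: fpsP => -[|n]; rewrite coef_mulX /forest_series [LHS]/=.
  by rewrite big_cons /= big_nil.
rewrite big_cons /= big_mkcond big_allpairs_dep /=.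
(* The size [i] of [l] becomes a summation index, in order to obtain a Cauchy product. *)
transitivity (\sum_(l <- forests n) \sum_(i < n.+1 | nodes l == i)
   \sum_(r <- forests n | (nroots r == k) && (nodes r == n - i)%N) W (Bin l r)).
  apply: eq_bigr => l _; rewrite -big_mkcond /=.
  have [nl|nl] := leqP (nodes l) n; last first.
    rewrite !big1 // => [i /eqP il|r]; first by have := ltn_ord i; lia.
    by rewrite !eqSS => /andP[_ /eqP]; lia.
  rewrite (big_pred1 (Ordinal (nl : (nodes l < n.+1)%N))) => [|i].
    by apply: eq_bigl => r; rewrite !eqSS /=; congr (_ && _); apply/eqP/eqP; lia.
  by rewrite eq_sym; apply/eqP/eqP => [ij|->] //; apply: val_inj.
rewrite (exchange_big_dep xpredT) //=; apply: eq_bigr => i _.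
have iN : (i <= n)%N by rewrite -ltnS.
transitivity ((\sum_(l <- forests n | nodes l == i)
    park_shift u (fpsC (q (a (nroots l))) * (EK * W l)))
  * \sum_(r <- forests n | (nroots r == k) && (nodes r == n - i)%N) W r).
  rewrite mulr_suml; apply: eq_bigr => l _.
  by rewrite mulr_sumr; apply: eq_bigr.
congr (_ * _); last by rewrite sum_forests_stable ?leq_subr.
have := @sum_forests_stable _
  (fun l => park_shift u (fpsC (q (a (nroots l))) * (EK * W l))) xpredT n i iN.
move=> /= ->.
rewrite -raddf_sum; congr park_shift.
transitivity (EK * aG i); last exact: esym (coef_mulC _ _ _).
rewrite /aG /= mulr_sumr.
transitivity (\sum_(l <- forests i | nodes l == i) \sum_(j < i.+1 | nroots l == j)
    EK * (fpsC (q (a j)) * W l)).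
  apply: eq_bigr => l /eqP nl.
  have rl : (nroots l < i.+1)%N by rewrite ltnS -nl nroots_nodes.
  rewrite (big_pred1 (Ordinal rl)) => [|j]; first by rewrite mulrCA.
  by rewrite eq_sym; apply/eqP/eqP => [ij|->] //; apply: val_inj.
rewrite (exchange_big_dep xpredT) //=; apply: eq_bigr => j _.
rewrite -!mulr_sumr; congr (_ * (_ * _)).
by apply: eq_bigl => l; rewrite andbC.
Qed.
End TreeSeries.
End ForestSeries.

(** A plane forest with [k] roots is a sequence of [k] trees and has the series [H ^+ k]; the sum
    over the number of children of a root is therefore a(H). *)
Lemma tree_gfI (a E : fps rat) (F : zu_series) :
  (forall n, F n = (\sum_(s <- forests n | (nroots s == 1%N) && (nodes s == n))
                     weight polyC 'X a (map_fps polyC E) s) 0%N) ->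
  tree_gf a E F.
Proof.
move=> FE; pose H := forest_series polyC 'X a E 1.
exists H; last exact: fpsP.
have HX k : forest_series polyC 'X a E k = H ^+ k.
  elim: k => [|k IHk]; first by rewrite forest_series0.
  rewrite exprS -IHk forest_seriesS mulrA; congr (_ * _).
  by rewrite /H forest_seriesS forest_series0 mulr1.
rewrite {1}/H forest_seriesS forest_series0 mulr1; congr (_ * shiftA _ (_ * _)).
apply: fpsP => n; rewrite coef_evalf; apply: eq_bigr => k _.
by rewrite coef_mulC HX.
Qed.

(** * Forests with drivers *)

(* cs lists the numbers of drivers that prefer the successive nodes of s in
   preorder; flow counts the drivers leaving the forest, and free the nodes that
   stay unoccupied. *)
Fixpoint flow s (cs : seq nat) : nat :=
  if s is Bin l r then
    ((head 0 cs + flow l (take (nodes l) (behead cs))).-1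
     + flow r (drop (nodes l) (behead cs)))%N
  else 0%N.

Fixpoint free s (cs : seq nat) : nat :=
  if s is Bin l r then
    ((head 0 cs + flow l (take (nodes l) (behead cs)) == 0)
     + free l (take (nodes l) (behead cs))
     + free r (drop (nodes l) (behead cs)))%N
  else 0%N.

(** An occupied node holds exactly one driver. With zero flow this identifies the number of free
    nodes, the exponent of [u], with n - m. *)
Lemma flow_free s cs : size cs = nodes s ->
  (sumn cs + free s cs = nodes s + flow s cs)%N.
Proof.
elim: s cs => [|l IHl r IHr] [|c cs] //= [sz].
have := IHl (take (nodes l) cs); have := IHr (drop (nodes l) cs).
rewrite size_drop size_take_min sz -[in sumn cs](cat_take_drop (nodes l) cs) sumn_cat.
move=> /(_ ltac:(lia)) Hr /(_ ltac:(lia)) Hl.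
by case: eqP => /=; lia.
Qed.

Fixpoint lists N n : seq (seq nat) :=
  if n is n'.+1 then [seq c :: cs | c <- iota 0 N, cs <- lists N n'] else [:: [::]].

Lemma mem_lists N n cs :
  (cs \in lists N n) = (size cs == n) && all (fun c => c < N)%N cs.
Proof.
elim: n cs => [|n IHn] [|c cs] //=; first by apply/allpairsP => -[[c' cs'] []].
rewrite eqSS; apply/allpairsP/idP => /= [[[c' cs'] /= [cN csN [-> ->]]]|].
  by rewrite andbCA -IHn csN andbT; move: cN; rewrite mem_iota.
rewrite andbCA -IHn => /andP[cN csN]; exists (c, cs).
by rewrite mem_iota.
Qed.

Lemma lists_uniq N n : uniq (lists N n).
Proof.
elim: n => //= n IHn; apply: allpairs_uniq; rewrite ?iota_uniq //.
by move=> -[c cs] [c' cs'] _ _ /= [-> ->].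
Qed.

Lemma big_lists_cat (V : nmodType) N m n (f : seq nat -> V) :
  \sum_(cs <- lists N (m + n)) f cs
  = \sum_(cl <- lists N m) \sum_(cr <- lists N n) f (cl ++ cr).
Proof.
elim: m f => [|m IHm] f; first by rewrite big_seq1.
rewrite addSn /= !big_allpairs_dep; apply: eq_bigr => c _.
by rewrite IHm.
Qed.

Section DriverSums.
Variables (K : comNzRingType) (q : {rmorphism rat -> K}) (u : K) (a : fps rat).

Fixpoint degree_weight s : rat :=
  if s is Bin l r then a (nroots l) * degree_weight l * degree_weight r else 1.

Variable E : fps rat.

Let EN N : fps K := \sum_(c < N) fpsC (q (E c)) * fpsX K ^+ c.

Let term s cs : fps K :=
  fpsC (q (degree_weight s) * q (\prod_(c <- cs) E c) * u ^+ free s cs)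
  * fpsX K ^+ flow s cs.

Lemma coef_monomial c k n : (fpsC c * fpsX K ^+ k) n = c * (n == k)%:R.
Proof. by rewrite coef_mulC coef_fpsXn. Qed.

Lemma park_shift_monomial c k :
  park_shift u (fpsC c * fpsX K ^+ k)
  = fpsC (c * u ^+ (k == 0%N)) * fpsX K ^+ k.-1.
Proof.
apply: fpsP => n; rewrite coef_monomial; set f := fpsC c * _.
transitivity (f n.+1 + (if n == 0%N then u * f 0%N else 0)) => //.
rewrite {}/f !coef_monomial.
case: k n => [|k] [|n] //=; rewrite ?eqSS ?expr0 ?expr1; ring.
Qed.

Lemma weight_lists N s :
  weight q u a (EN N) s = \sum_(cs <- lists N (nodes s)) term s cs.
Proof.
elim: s => [|l IHl r IHr].
  by rewrite /= big_seq1 /term /= big_nil !rmorph1 !mulr1 rmorph1.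
rewrite [LHS]/= IHl IHr.
transitivity (\sum_(c <- iota 0 N) \sum_(cs <- lists N (nodes l + nodes r))
    term (Bin l r) (c :: cs)); last by rewrite -big_allpairs_dep.
have -> : iota 0 N = index_iota 0 N by rewrite /index_iota subn0.
rewrite big_mkord.
rewrite /EN mulr_suml mulr_sumr raddf_sum mulr_suml; apply: eq_bigr => c _.
rewrite big_lists_cat.
have [R RE] : exists R, R = \sum_(cr <- lists N (nodes r)) term r cr by eexists.
rewrite -[X in _ * X = _]RE.
rewrite !mulr_sumr raddf_sum mulr_suml big_seq [RHS]big_seq.
apply: eq_bigr => cl; rewrite mem_lists => /andP[/eqP scl _].
rewrite RE mulr_sumr; apply: eq_bigr => cr _.
rewrite /term /= -scl take_size_cat // drop_size_cat //.
rewrite (_ : fpsC _ * _ = fpsC (q (a (nroots l)) * q (E c) * (q (degree_weight l)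
    * q (\prod_(c0 <- cl) E c0) * u ^+ free l cl)) * fpsX K ^+ (c + flow l cl)).
  rewrite park_shift_monomial big_cons big_cat /=.
  rewrite exprD !rmorphM !exprD /= !rmorphM; ring.
rewrite exprD !rmorphM; ring.
Qed.

Lemma eqm_park_shift M f g : eqm M.+1 f g -> eqm M (park_shift u f) (park_shift u g).
Proof. by move=> fg n nM; rewrite /= !fg. Qed.

(** Every node applies [park_shift] once, and each shift costs one degree of precision in [x]. *)
Lemma weight_congr (E1 E2 : fps K) s M : eqm (M + nodes s) E1 E2 ->
  eqm M (weight q u a E1 s) (weight q u a E2 s).
Proof.
elim: s M => [|l IHl r IHr] M //= EE; apply: eqmM; last first.
  by apply: IHr; apply: eqm_leq EE; lia.
apply: eqm_park_shift; apply: eqmM => //; apply: eqmM.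
  by apply: eqm_leq EE; lia.
by apply: IHl; apply: eqm_leq EE; lia.
Qed.

(** The coefficient of x^0 selects the load lists from which nobody leaves. It sees [E] only up to
    degree [nodes s], so [E] may be replaced by the polynomial [EN N], whose powers can be expanded
    over finitely many lists. *)
Lemma weight_coef0 N s : (nodes s < N)%N ->
  weight q u a (map_fps q E) s 0%N
  = q (degree_weight s) * \sum_(cs <- lists N (nodes s) | flow s cs == 0%N)
      q (\prod_(c <- cs) E c) * u ^+ (nodes s - sumn cs).
Proof.
move=> sN.
have -> : weight q u a (map_fps q E) s 0%N = weight q u a (EN N) s 0%N.
  apply: (@weight_congr _ _ _ 1) => // n nN; rewrite /EN coef_sumE.
  have nN' : (n < N)%N by lia.
  under eq_bigr do rewrite coef_monomial.
  rewrite (bigD1 (Ordinal nN')) //= eqxx mulr1 big1 ?addr0 // => i iN.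
  case: eqP => [ni|]; last by rewrite mulr0.
  by case/eqP: iN; apply: val_inj.
rewrite weight_lists coef_sumE mulr_sumr [RHS]big_mkcond big_seq [RHS]big_seq.
apply: eq_bigr => cs; rewrite mem_lists => /andP[/eqP scs _].
rewrite coef_monomial eq_sym; case: eqP => [f0|_]; last by rewrite mulr0.
have := flow_free scs; rewrite f0 => fr.
by rewrite mulr1 mulrA; congr (_ * _ ^+ _); lia.
Qed.
End DriverSums.

(** * Labelled forests *)

Inductive lforest (T : Type) := LLeaf | LBin of T & lforest T & lforest T.
Arguments LLeaf {T}.

Section LabelledForests.
Variable T : Type.
Implicit Type B : lforest T.

Fixpoint labels B : seq T :=
  if B is LBin v l r then v :: labels l ++ labels r else [::].
Fixpoint root_labels B : seq T :=
  if B is LBin v l r then v :: root_labels r else [::].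
Fixpoint unlabel B : forest :=
  if B is LBin v l r then Bin (unlabel l) (unlabel r) else Leaf.

Fixpoint label (x : T) s (ls : seq T) : lforest T :=
  if s is Bin l r then
    LBin (head x ls) (label x l (take (nodes l) (behead ls)))
         (label x r (drop (nodes l) (behead ls)))
  else LLeaf.

Lemma size_labels B : size (labels B) = nodes (unlabel B).
Proof. by elim: B => //= v l IHl r IHr; rewrite size_cat IHl IHr. Qed.

Lemma size_root_labels B : size (root_labels B) = nroots (unlabel B).
Proof. by elim: B => //= v l _ r ->. Qed.

Lemma unlabelK x B : label x (unlabel B) (labels B) = B.
Proof.
elim: B => //= v l IHl r IHr; rewrite -size_labels.
by rewrite take_size_cat // drop_size_cat // IHl IHr.
Qed.

Lemma labelK x s ls : size ls = nodes s ->
  unlabel (label x s ls) = s /\ labels (label x s ls) = ls.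
Proof.
elim: s ls => [|l IHl r IHr] [|v ls] //= [sz].
have [| -> ->] := IHl (take (nodes l) ls).
  by rewrite size_take_min sz; apply/minn_idPl; apply: leq_addr.
have [| -> ->] := IHr (drop (nodes l) ls); first by rewrite size_drop sz addKn.
by rewrite cat_take_drop.
Qed.
End LabelledForests.

Section Realization.
Variable V : finType.
Implicit Types (kappa : V -> seq V) (B : lforest V).

(** Relates two descriptions of a forest: child lists [kappa], as in [pretree], and an inductive
    term [B]. Given the roots, [kappa] determines [B] ([real_inj]); conversely [B] determines
    [kappa] on its labels ([real_determined]). *)
Fixpoint real kappa B : bool :=
  if B is LBin v l r then
    [&& kappa v == root_labels l, real kappa l & real kappa r]
  else true.

Lemma real_inj kappa B B' : real kappa B -> real kappa B' ->
  root_labels B = root_labels B' -> B = B'.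
Proof.
elim: B B' => [|v l IHl r IHr] [|v' l' r'] //=.
move=> /and3P[/eqP kl rl rr] /and3P[/eqP kl' rl' rr'] [vv rootsE].
rewrite -vv kl in kl' *.
by rewrite (IHl l') // (IHr r').
Qed.

Lemma real_ext kappa kappa' B : {in labels B, kappa =1 kappa'} ->
  real kappa B = real kappa' B.
Proof.
elim: B => //= v l IHl r IHr kk; rewrite kk ?mem_head // IHl ?IHr //.
  by move=> w wr; apply: kk; rewrite inE mem_cat wr !orbT.
by move=> w wl; apply: kk; rewrite inE mem_cat wl orbT.
Qed.

Lemma real_determined kappa kappa' B : real kappa B -> real kappa' B ->
  {in labels B, kappa =1 kappa'}.
Proof.
elim: B => //= v l IHl r IHr /and3P[/eqP kl rl rr] /and3P[/eqP kl' rl' rr'] w.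
rewrite inE mem_cat => /or3P[/eqP ->|wl|wr]; first by rewrite kl.
  exact: IHl.
exact: IHr.
Qed.

Lemma real_perm kappa B : real kappa B ->
  perm_eq (labels B) (root_labels B ++ flatten [seq kappa v | v <- labels B]).
Proof.
elim: B => //= v l IHl r IHr /and3P[/eqP kl rl rr].
rewrite perm_cons map_cat flatten_cat kl.
apply: perm_trans (perm_cat (IHl rl) (IHr rr)) _.
rewrite -!catA perm_sym; apply/permP => p; rewrite !count_cat; lia.
Qed.

Lemma real_child kappa B v w : real kappa B -> w \in labels B -> v \in kappa w ->
  v \in labels B.
Proof.
move=> rB wB vw; rewrite (perm_mem (real_perm rB)) mem_cat; apply/orP; right.
by apply/flattenP; exists (kappa w); rewrite // map_f.
Qed.

Lemma root_labels_sub B : {subset root_labels B <= labels B}.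
Proof.
elim: B => //= v l _ r IHr w; rewrite !inE mem_cat => /predU1P[->|/IHr ->].
  by rewrite eqxx.
by rewrite !orbT.
Qed.

Lemma real_connect kappa B v : real kappa B -> v \in labels B ->
  exists2 r, r \in root_labels B & connect (fun x y => y \in kappa x) r v.
Proof.
elim: B => //= w l IHl r IHr /and3P[/eqP kl rl rr].
rewrite inE mem_cat => /or3P[/eqP ->|/(IHl rl)[x xl xv]|/(IHr rr)[x xr xv]].
- by exists w; rewrite ?mem_head.
- exists w; rewrite ?mem_head //; apply: connect_trans xv.
  by apply: connect1; rewrite kl.
by exists x; rewrite // inE xr orbT.
Qed.

Fixpoint children B (v : V) : seq V :=
  if B is LBin w l r then
    if v == w then root_labels l
    else if v \in labels l then children l v else children r v
  else [::].

Lemma size_children B v : (size (children B v) <= size (labels B))%N.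
Proof.
elim: B => //= w l IHl r IHr; rewrite size_cat.
have rl : (size (root_labels l) <= size (labels l))%N.
  by rewrite size_labels size_root_labels nroots_nodes.
by case: eqP => _; last case: ifP => _; lia.
Qed.

Lemma real_children B : uniq (labels B) -> real (children B) B.
Proof.
elim: B => //= w l IHl r IHr; rewrite mem_cat negb_or cat_uniq.
move=> /andP[/andP[wl wr] /and3P[ul lr ur]]; rewrite eqxx eqxx /=.
apply/andP; split.
  rewrite (@real_ext _ (children l)) ?IHl // => v vl.
  by rewrite vl; case: eqP => // vw; rewrite -vw vl in wl.
rewrite (@real_ext _ (children r)) ?IHr // => v vr.
case: eqP => [vw|_]; first by rewrite -vw vr in wr.
by case: ifP => // vl; case/hasP: lr; exists v.
Qed.
End Realization.

(** * Growing an inductive tree from child lists *)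

Section Growth.
Variable V : finType.
Variable kappa : V -> seq V.

(** Unfolds [k] generations; a bound is required since an arbitrary [kappa] may have cycles. *)
Fixpoint grow k (l : seq V) : lforest V :=
  if k is k'.+1 then foldr (fun v r => LBin v (grow k' (kappa v)) r) LLeaf l
  else LLeaf.

Let next (l : seq V) := flatten [seq kappa v | v <- l].
Let level k (l : seq V) := iter k next l.

Let level_cat k l1 l2 : level k (l1 ++ l2) = level k l1 ++ level k l2.
Proof. by elim: k => //= k ->; rewrite /next map_cat flatten_cat. Qed.

Let level_nil k : level k [::] = [::].
Proof. by elim: k => //= k ->. Qed.

Lemma real_grow k l : iter k next l = [::] ->
  real kappa (grow k l) /\ root_labels (grow k l) = l.
Proof.
elim: k l => [|k IHk] l; first by move=> /= ->.
elim: l => [//|v l IHl] H.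
have : nilp (level k.+1 [:: v] ++ level k.+1 l) by rewrite -level_cat [level _ _]H.
rewrite cat_nilp => /andP[/nilP v0 /nilP l0].
have [rl rl'] := IHl l0.
have [|rv rv'] := IHk (kappa v).
  by move: v0; rewrite /level iterSr /next /= cats0.
split; last by congr cons; apply: rl'.
by apply/and3P; split=> //; apply/eqP.
Qed.

Let mult k l v := (\sum_(j < k) count_mem v (level j l))%N.

Let multS k l v : mult k.+1 l v
  = (count_mem v l + \sum_w mult k l w * count_mem v (kappa w))%N.
Proof.
have count_next s : count_mem v (next s)
    = (\sum_w count_mem w s * count_mem v (kappa w))%N.
  elim: s => [|x s IHs].
    by rewrite big1 // => w _; rewrite mul0n.
  rewrite /next /= count_cat -/(next s) IHs [RHS](eq_bigr (fun w =>
    (x == w) * count_mem v (kappa w) + count_mem w s * count_mem v (kappa w))%N).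
    rewrite big_split /=; congr (_ + _)%N.
    rewrite (bigD1 x) //= eqxx mul1n big1 ?addn0 // => w wx.
    by rewrite eq_sym (negbTE wx).
  by move=> w _; rewrite mulnDl.
rewrite /mult big_ord_recl; congr (_ + _)%N.
transitivity (\sum_(j < k) \sum_w count_mem w (level j l) * count_mem v (kappa w))%N.
  by apply: eq_bigr => j _; rewrite -count_next.
by rewrite exchange_big; apply: eq_bigr => w _; rewrite -big_distrl.
Qed.

Let count_grow k l v : count_mem v (labels (grow k l)) = mult k l v.
Proof.
elim: k l => [|k IHk] l; first by rewrite /mult big_ord0.
have mult_cat l1 l2 : mult k.+1 (l1 ++ l2) v = (mult k.+1 l1 v + mult k.+1 l2 v)%N.
  by rewrite -big_split; apply: eq_bigr => j _; rewrite level_cat count_cat.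
elim: l => [|w l IHl].
  by rewrite /= /mult big1 // => j _; rewrite level_nil.
rewrite -[w :: l]cat1s mult_cat -IHl /= count_cat IHk addnA; congr (_ + _)%N.
rewrite /mult big_ord_recl; congr (_ + _)%N; first by rewrite /= addn0.
by apply: eq_bigr => j _; rewrite lift0 /level iterSr /next /= cats0.
Qed.

Variable r : V.
Hypothesis partition_kappa :
  perm_eq (r :: flatten [seq kappa v | v <- enum V]) (enum V).
Hypothesis connected : forall v, connect (fun x y => y \in kappa x) r v.

Let count_partition v :
  ((r == v) + \sum_w count_mem v (kappa w) = 1)%N.
Proof.
have := permP partition_kappa (pred1 v).
rewrite -cat1s count_cat count_flatten sumnE 2!big_map big_enum.
by rewrite (count_uniq_mem v (enum_uniq V)) mem_enum inE => /= <-; rewrite addn0.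
Qed.

(** By [count_partition], a vertex is either the root or a child, exactly once and of one vertex
    only; so if no vertex is repeated in [k] generations, [multS] excludes a repetition in
    [k.+1]. *)
Let mult_le1 k v : (mult k [:: r] v <= 1)%N.
Proof.
elim: k v => [|k IHk] v; first by rewrite /mult big_ord0.
rewrite multS -(count_partition v) /= addn0 leq_add2l; apply: leq_sum => w _.
by rewrite -[leqRHS]mul1n leq_mul2r IHk orbT.
Qed.

(** Otherwise all of the first [#|V|.+1] generations are non-empty, since an empty one has only
    empty successors. Together they would contain more than [#|V|] vertices, none of them repeated
    by [mult_le1]. *)
Let level_end : level #|V| [:: r] = [::].
Proof.
case: (boolP (nilp (level #|V| [:: r]))) => [/nilP //|nz].
have nzj j : (j <= #|V|)%N -> (0 < size (level j [:: r]))%N.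
  move=> jV; rewrite lt0n; apply: contra nz => /nilP j0.
  rewrite -(subnK jV) /level iterD -/(level j _) j0; apply/nilP.
  exact: level_nil.
have : (\sum_(j < #|V|.+1) 1 <= \sum_(j < #|V|.+1) size (level j [:: r]))%N.
  by apply: leq_sum => j _; apply: nzj; rewrite -ltnS.
rewrite sum1_card card_ord => H.
have : (\sum_v mult #|V|.+1 [:: r] v <= #|V|)%N.
  by rewrite -sum1_card; apply: leq_sum => v _; apply: mult_le1.
rewrite /mult exchange_big /= => H'.
suff S : (\sum_(j < #|V|.+1) size (level j [:: r])
          <= \sum_(j < #|V|.+1) \sum_v count_mem v (level j [:: r]))%N.
  by have := leq_trans H (leq_trans S H'); rewrite ltnn.
apply: leq_sum => j _.
elim: (level j [:: r]) => //= w s IHs; rewrite big_split /= -add1n leq_add //.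
by rewrite (bigD1 w) //= eqxx.
Qed.

(** No label is repeated, by [mult_le1]. None is missing, by connectedness: the labels contain the
    root and are closed under children because the next generation is empty. *)
Lemma tree_realized : exists B,
  [/\ real kappa B, root_labels B = [:: r] & perm_eq (labels B) (enum V)].
Proof.
have [rB rootB] := real_grow level_end.
exists (grow #|V| [:: r]); split=> //.
have multE v : mult #|V|.+1 [:: r] v = mult #|V| [:: r] v.
  by rewrite /mult big_ord_recr level_end /= addn0.
have allin v : v \in labels (grow #|V| [:: r]).
  have inE' w : (w \in labels (grow #|V| [:: r])) = (0 < mult #|V|.+1 [:: r] w)%N.
    by rewrite multE -count_grow -has_count has_pred1.
  have closed x y : x \in labels (grow #|V| [:: r]) -> y \in kappa x ->
      y \in labels (grow #|V| [:: r]).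
    rewrite inE' => xin yx; rewrite inE' multS (bigD1 x) //= -multE.
    have : (0 < count_mem y (kappa x))%N by rewrite -has_count has_pred1.
    by move=> yx'; have := muln_gt0 (mult #|V|.+1 [:: r] x) (count_mem y (kappa x));
      rewrite xin yx' /=; lia.
  have path_in x p : x \in labels (grow #|V| [:: r]) ->
      path (fun x y => y \in kappa x) x p -> last x p \in labels (grow #|V| [:: r]).
    elim: p x => //= y p IHp x xin /andP[xy pth].
    by apply: IHp => //; apply: closed xy.
  have /connectP[p pth ->] := connected v; apply: path_in => //.
  by rewrite root_labels_sub // rootB mem_head.
apply: uniq_perm; rewrite ?enum_uniq //; last by move=> v; rewrite allin mem_enum.
apply: count_mem_uniq => v; rewrite allin; apply/eqP.
by rewrite eqn_leq {1}count_grow mult_le1 -has_count has_pred1 allin.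
Qed.
End Growth.

Section CountingTrees.
Variable n : nat.

Definition children_of (A : family) (T : pretree A n) : 'I_n -> seq 'I_n :=
  fun v => kids (T v).

Definition realizes (A : family) (T : pretree A n) (B : lforest 'I_n) r :=
  [/\ real (children_of T) B, root_labels B = [:: r]
    & perm_eq (labels B) (enum 'I_n)].

Lemma realizes_root (A : family) (T : pretree A n) B r : realizes T B r ->
  perm_eq (r :: flatten [seq kids (T v) | v <- enum 'I_n]) (enum 'I_n).
Proof.
move=> [rB rootB permB]; rewrite perm_sym; apply: perm_trans (perm_trans _ (real_perm rB)) _.
  by rewrite perm_sym.
rewrite rootB /= perm_cons; apply: perm_flatten; apply: perm_map; exact: permB.
Qed.

Lemma is_treeP (A : family) (T : pretree A n) :
  reflect (exists B r, realizes T B r) (is_tree T).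
Proof.
apply: (iffP existsP) => [[r /andP[pT /forallP cT]]|[B [r TB]]].
  by have [B TB] := tree_realized pT cT; exists B, r.
exists r; rewrite (realizes_root TB); apply/forallP => v.
have [rB rootB permB] := TB.
have := @real_connect _ _ B v rB; rewrite (perm_mem permB) mem_enum rootB.
by case=> // r'; rewrite inE => /eqP ->.
Qed.

(** The root is the one vertex that is no child, so the child lists determine it, and [real_inj]
    applies. *)
Lemma realizes_unique (A : family) (T : pretree A n) B B' r r' :
  realizes T B r -> realizes T B' r' -> B = B'.
Proof.
move=> TB TB'; have [rB rootB _] := TB; have [rB' rootB' _] := TB'.
apply: real_inj rB rB' _; rewrite rootB rootB'; congr [:: _].
have p' := realizes_root TB'; rewrite perm_sym in p'.
have := perm_trans (realizes_root TB) p'.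
rewrite -cat1s -[r' :: _]cat1s perm_cat2r => /perm_small_eq -/(_ isT).
by case.
Qed.

Lemma exists_realizing B : uniq (labels B) -> (size (labels B) <= n)%N ->
  exists T : pretree ordered n, forall v, children_of T v = children B v.
Proof.
move=> uB sB.
exists [ffun v => Bseq (leq_trans (size_children B v) sB)] => v.
by rewrite /children_of /= ffunE.
Qed.

(** A double count of the incidences between trees [T] and pairs of a shape [s] and an order [ls] of
    the labels: each tree realizes exactly one pair and each pair is realized by exactly one tree,
    with [n]! orders for every shape. *)
Lemma sum_ordered_trees (V : nmodType) (f : pretree ordered n -> V) (g : forest -> V) :
  (0 < n)%N ->
  (forall T B r, realizes T B r -> f T = g (unlabel B)) ->
  \sum_(T | is_tree T) f T
  = (\sum_(s <- forests n | (nroots s == 1%N) && (nodes s == n)) g s) *+ n`!.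
Proof.
move=> n_gt0 fg; pose x0 := Ordinal n_gt0.
pose F := [seq s <- forests n | (nroots s == 1%N) && (nodes s == n)].
pose L := permutations (enum 'I_n).
have F_uniq : uniq F by rewrite filter_uniq ?forests_uniq.
have memF s : (s \in F) = (nroots s == 1%N) && (nodes s == n).
  rewrite mem_filter mem_forests; case: eqP => //= _; case: eqP => //= <-.
  exact: height_nodes.
have L_uniq : uniq L by apply: permutations_uniq.
have sizeL ls : ls \in L -> size ls = n.
  by rewrite mem_permutations => /perm_size; rewrite size_enum_ord.
have root1 B : nroots (unlabel B) = 1%N -> exists r : 'I_n, root_labels B = [:: r].
  by rewrite -size_root_labels; case: (root_labels B) => [|r []] // _; exists r.
have realP T s ls : s \in F -> ls \in L ->
    real (children_of T) (label x0 s ls) ->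
    exists r, realizes T (label x0 s ls) r.
  rewrite memF => /andP[/eqP s1 /eqP sn] lsL rs.
  have [us lls] := @labelK _ x0 s ls (etrans (sizeL _ lsL) (esym sn)).
  have [r rE] := root1 (label x0 s ls) (etrans (congr1 _ us) s1).
  by exists r; split; rewrite // lls -mem_permutations.
rewrite -[in RHS]big_filter -/F -sumrMnl.
transitivity (\sum_(T : pretree ordered n) \sum_(s <- F) \sum_(ls <- L)
    if real (children_of T) (label x0 s ls) then g s else 0).
  rewrite big_mkcond; apply: eq_bigr => T _.
  case: is_treeP => [[B [r TB]]|notT]; last first.
    rewrite big_seq big1 // => s sF; rewrite big_seq big1 // => ls lsL.
    case: ifP => // /(realP _ T s ls sF lsL)[r Tr].
    by case: notT; exists (label x0 s ls), r.
  have [rB rootB permB] := TB.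
  have lB : labels B \in L by rewrite mem_permutations.
  have uB : unlabel B \in F.
    by rewrite memF -size_root_labels rootB -size_labels (sizeL _ lB) eqxx.
  (* The pair of [T] is read off [B]; a second pair would give a second term realizing [T], against
     [realizes_unique]. *)
  rewrite (bigD1_seq (unlabel B)) //= (bigD1_seq (labels B)) //= unlabelK rB.
  rewrite (fg _ _ _ TB) [X in _ + X + _]big_seq_cond [X in _ + X + _]big1 => [|ls].
    rewrite addr0 [X in _ + X]big_seq_cond [X in _ + X]big1 ?addr0 // => s.
    move=> /andP[sF sB]; rewrite big_seq big1 // => ls lsL.
    case: ifP => // /(realP _ T s ls sF lsL)[r' Tr]; case/eqP: sB.
    have sn : size ls = nodes s.
      by move: sF; rewrite memF (sizeL _ lsL) => /andP[_ /eqP ->].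
    have [us _] := labelK x0 sn.
    by rewrite -[LHS]us -(realizes_unique TB Tr).
  move=> /andP[lsL lsB]; case: ifP => // /(realP _ T _ ls uB lsL)[r' Tr].
  case/eqP: lsB; have sn : size ls = nodes (unlabel B).
    by rewrite -size_labels !sizeL.
  have [_ lls] := labelK x0 sn.
  by rewrite -[LHS]lls -(realizes_unique TB Tr).
rewrite exchange_big big_seq [RHS]big_seq; apply: eq_bigr => s sF.
rewrite exchange_big.
transitivity (\sum_(ls <- L) g s); last first.
  rewrite big_const_seq count_predT size_permutations ?enum_uniq //.
  by rewrite size_enum_ord iter_addr_0.
rewrite big_seq [RHS]big_seq; apply: eq_bigr => ls lsL.
have sn : size ls = nodes s.
  by move: sF; rewrite memF (sizeL _ lsL) => /andP[_ /eqP ->].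
have [us lls] := labelK x0 sn.
have permls : perm_eq ls (enum 'I_n) by rewrite -mem_permutations.
have uls : uniq ls by rewrite (perm_uniq permls) enum_uniq.
have ub : uniq (labels (label x0 s ls)) by rewrite lls.
have [|T0 T0E] := exists_realizing ub; first by rewrite lls sizeL.
have rT0 : real (children_of T0) (label x0 s ls).
  by rewrite (@real_ext _ _ (children (label x0 s ls))) ?real_children // => v _.
(* Conversely [T0] is the only tree of this pair, because the labelled shape fixes all child
   lists. *)
rewrite (bigD1 T0) //= rT0 big1 ?addr0 // => T TT0.
case: ifP => // rT; case/eqP: TT0; apply/ffunP => v; apply: val_inj.
apply: (real_determined rT rT0).
by rewrite lls (perm_mem permls) mem_enum.
Qed.
End CountingTrees.

(** * Parking *)

Section Flow.
Variable V : finType.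
Implicit Types (B : lforest V) (d : V -> nat) (kappa : V -> seq V).

Fixpoint lflow B d : nat :=
  if B is LBin v l r then ((d v + lflow l d).-1 + lflow r d)%N else 0%N.

Fixpoint depth B v : nat :=
  if B is LBin w l r then
    if v == w then 0%N
    else if v \in labels l then (depth l v).+1 else depth r v
  else 0%N.

Definition add_driver d v : V -> nat := fun w => (d w + (w == v))%N.

Lemma lflowE B d : lflow B d = flow (unlabel B) [seq d v | v <- labels B].
Proof.
elim: B => //= v l IHl r IHr; rewrite map_cat.
have sl : size [seq d v | v <- labels l] = nodes (unlabel l).
  by rewrite size_map size_labels.
by rewrite -sl take_size_cat // drop_size_cat // IHl IHr.
Qed.

Lemma eq_lflow B d d' : {in labels B, d =1 d'} -> lflow B d = lflow B d'.
Proof.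
elim: B => //= v l IHl r IHr dd; rewrite dd ?mem_head // IHl ?IHr //.
  by move=> w wr; apply: dd; rewrite inE mem_cat wr !orbT.
by move=> w wl; apply: dd; rewrite inE mem_cat wl orbT.
Qed.

Lemma lflow_add_notin B d v : v \notin labels B ->
  lflow B (add_driver d v) = lflow B d.
Proof.
move=> vB; apply: eq_lflow => w wB; rewrite /add_driver.
by case: eqP => [wv|]; rewrite ?addn0 //; rewrite wv (negbTE vB) in wB.
Qed.

Lemma lflow_le1 B d : (forall v, d v <= 1)%N -> lflow B d = 0%N.
Proof.
move=> d1; elim: B => //= v l -> r ->; have := d1 v; lia.
Qed.

Lemma LBin_uniq (v : V) (l r : lforest V) : uniq (labels (LBin v l r)) ->
  [/\ v \notin labels l, v \notin labels r, uniq (labels l), uniq (labels r)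
    & {in labels r, forall w, w \notin labels l}].
Proof.
rewrite /= mem_cat negb_or cat_uniq => /andP[/andP[vl vr] /and3P[ul lr ur]].
split=> // w wr; apply: contra lr => wl; by apply/hasP; exists w.
Qed.

(** A root that already has a driver passes every further one on; [0 < d v] keeps the predecessor in
    [lflow] away from 0. *)
Lemma lflow_root B d v : uniq (labels B) -> v \in root_labels B -> (0 < d v)%N ->
  lflow B (add_driver d v) = (lflow B d).+1.
Proof.
elim: B => [//|w l IHl r IHr] /LBin_uniq[wl wr ul ur lr]; rewrite inE => /predU1P[->|vr] dv /=.
  rewrite !lflow_add_notin // /add_driver eqxx.
  by move: (d w) (lflow l d) (lflow r d) dv; clear; lia.
have vr' := root_labels_sub vr.
rewrite IHr // lflow_add_notin ?lr // /add_driver.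
have /negbTE -> : w != v by apply: contraNneq wr => ->.
by rewrite addn0 addnS.
Qed.

(** One step of a driver's walk. By [lflow_root], applied to the forest below [w], an additional
    driver at the occupied node [v] is an additional driver arriving at its parent [w]. *)
Lemma lflow_step kappa B d v w : uniq (labels B) -> real kappa B ->
  w \in labels B -> v \in kappa w -> (0 < d v)%N ->
  lflow B (add_driver d v) = lflow B (add_driver d w).
Proof.
elim: B => [//|x l IHl r IHr] uB; have [xl xr ul ur lr] := LBin_uniq uB.
move=> /= /and3P[/eqP kx rl rr]; rewrite inE mem_cat => wB vw dv.
case/or3P: wB => [/eqP wx|wl|wr].
- rewrite wx in vw *; rewrite kx in vw; have vl := root_labels_sub vw.
  have vx : (x == v) = false by apply: contraNF xl => /eqP ->.
  have vr : v \notin labels r by apply: contraL vl => /lr.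
  rewrite (lflow_root ul vw dv) !lflow_add_notin // /add_driver vx eqxx.
  by rewrite addn0 addn1 addnS addSn.
- have vl := real_child rl wl vw.
  have vx : (x == v) = false by apply: contraNF xl => /eqP ->.
  have wx : (x == w) = false by apply: contraNF xl => /eqP ->.
  have vr : v \notin labels r by apply: contraL vl => /lr.
  have wr : w \notin labels r by apply: contraL wl => /lr.
  rewrite (IHl ul rl wl vw dv) !(lflow_add_notin _ vr) !(lflow_add_notin _ wr).
  by rewrite /add_driver vx wx.
have vr := real_child rr wr vw.
have vx : (x == v) = false by apply: contraNF xr => /eqP ->.
have wx : (x == w) = false by apply: contraNF xr => /eqP ->.
rewrite (IHr ur rr wr vw dv) (lflow_add_notin _ (lr _ vr)).
by rewrite (lflow_add_notin _ (lr _ wr)) /add_driver vx wx.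
Qed.

Lemma depth_root B v : uniq (labels B) -> v \in root_labels B -> depth B v = 0%N.
Proof.
elim: B => [//|w l IHl r IHr] /LBin_uniq[wl wr ul ur lr]; rewrite inE /=.
case: eqP => //= _ vr.
by rewrite (negbTE (lr _ (root_labels_sub vr))) IHr.
Qed.

Lemma depth_step kappa B v w : uniq (labels B) -> real kappa B ->
  w \in labels B -> v \in kappa w -> depth B v = (depth B w).+1.
Proof.
elim: B => [//|x l IHl r IHr] uB; have [xl xr ul ur lr] := LBin_uniq uB.
move=> /= /and3P[/eqP kx rl rr]; rewrite inE mem_cat => wB vw.
case/or3P: wB => [/eqP wx|wl|wr].
- rewrite wx in vw *; rewrite kx in vw; have vl := root_labels_sub vw.
  have vx : (v == x) = false by apply: contraNF xl => /eqP <-.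
  by rewrite vx vl eqxx depth_root.
- have vl := real_child rl wl vw.
  have vx : (v == x) = false by apply: contraNF xl => /eqP <-.
  have wx : (w == x) = false by apply: contraNF xl => /eqP <-.
  by rewrite vx wx vl wl (IHl ul rl wl vw).
have vr := real_child rr wr vw.
have vx : (v == x) = false by apply: contraNF xr => /eqP <-.
have wx : (w == x) = false by apply: contraNF xr => /eqP <-.
by rewrite vx wx (negbTE (lr _ vr)) (negbTE (lr _ wr)) (IHr ur rr wr vw).
Qed.

Lemma depth_lt B v : v \in labels B -> (depth B v < size (labels B))%N.
Proof.
elim: B => //= w l IHl r IHr; rewrite inE mem_cat size_cat.
case: eqP => //= _; case: (boolP (v \in labels l)) => /= [/IHl|_ /IHr]; lia.
Qed.
End Flow.

Section Parking.
Variables (n : nat) (A : family) (T : pretree A n) (B : lforest 'I_n) (r : 'I_n).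
Hypothesis TB : realizes T B r.

Let rB : real (children_of T) B. Proof. by case: TB. Qed.
Let permB : perm_eq (labels B) (enum 'I_n). Proof. by case: TB. Qed.
Let uB : uniq (labels B). Proof. by rewrite (perm_uniq permB) enum_uniq. Qed.
Let allB v : v \in labels B. Proof. by rewrite (perm_mem permB) mem_enum. Qed.

Lemma parent_Some v w : parent T v = Some w -> v \in kids (T w).
Proof. by rewrite /parent; case: pickP => // w' vw' [<-]. Qed.

Lemma parent_None v : parent T v = None -> v \in root_labels B.
Proof.
rewrite /parent; case: pickP => // novw _.
have := allB v; rewrite (perm_mem (real_perm rB)) mem_cat => /orP[//|].
by case/flattenP => _ /mapP[w _ ->]; rewrite -[_ \in _]/(v \in kids (T w)) novw.
Qed.

(* The parked drivers count as drivers that prefer the nodes they occupy. *)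
Let load (c : 'I_n -> nat) (occ : {set 'I_n}) v := (c v + (v \in occ))%N.

(** The walk keeps the flow as long as it meets occupied nodes, by [lflow_step]. At a free node the
    driver moves from the preferences to [occ]; beyond the root one more driver leaves, by
    [lflow_root]. [c] stands for the drivers still to come. *)
Lemma first_free_flow k v c occ : (depth B v < k)%N ->
  lflow B (add_driver (load c occ) v)
  = if first_free T occ k v is Some w then lflow B (load c (w |: occ))
    else (lflow B (load c occ)).+1.
Proof.
elim: k v => // k IHk v vk /=.
case: (boolP (v \in occ)) => /= vocc; last first.
  apply: eq_lflow => w _; rewrite /add_driver /load -addnA; congr (_ + _)%N.
  by rewrite in_setU1; case: eqP => [->|_]; rewrite ?(negbTE vocc) ?addn0.
have dv : (0 < load c occ v)%N by rewrite /load vocc addn1.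
case pv : (parent T v) => [w|].
  have vw : v \in children_of T w by apply: parent_Some pv.
  rewrite (lflow_step uB rB (allB w) vw dv) IHk //.
  by rewrite (depth_step uB rB (allB w) vw) in vk.
by rewrite lflow_root //; apply: parent_None pv.
Qed.

(** Drivers pass one by one from the preferences to [occ], and the flow drops by one exactly when a
    driver leaves. In the end all loads are at most 1 and the flow is 0. *)
Lemma outcomes_flow s occ :
  lflow B (load (fun v => count_mem v s) occ)
  = count (fun o => ~~ isSome o) (outcomes T occ s).
Proof.
elim: s occ => [|v s IHs] occ /=.
  by apply: lflow_le1 => v; rewrite /load /=; case: (v \in occ).
transitivity (lflow B (add_driver (load (fun v => count_mem v s) occ) v)).
  by apply: eq_lflow => w _; rewrite /add_driver /load /= [w == v]eq_sym -addnA addnC.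
rewrite (@first_free_flow n); last first.
  by rewrite -{2}(size_enum_ord n) -(perm_size permB) depth_lt.
rewrite -/(park T occ v); case: (park T occ v) => [w|] /=; first exact: IHs.
by rewrite IHs.
Qed.

Lemma parking_functionE s : parking_function T s
  = (flow (unlabel B) [seq count_mem v s | v <- labels B] == 0%N).
Proof.
have -> : parking_function T s = all isSome (outcomes T set0 s).
  by rewrite /parking_function; case: is_treeP => // -[]; exists B, r.
rewrite -lflowE -(@eq_lflow _ _ (load (fun v => count_mem v s) set0)); last first.
  by move=> v _; rewrite /load inE addn0.
rewrite outcomes_flow; elim: (outcomes T set0 s) => //= o os ->.
by case: o.
Qed.
End Parking.

(** * Preference sequences with given multiplicities *)

Lemma sum_count_mem (V : finType) (s : seq V) : (\sum_v count_mem v s = size s)%N.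
Proof.
elim: s => [|x s IHs]; first by rewrite big1.
rewrite big_split /= IHs (bigD1 x) //= eqxx big1 ?addn0 // => v vx.
by rewrite eq_sym (negbTE vx).
Qed.

Lemma card_tuples_content (V : finType) m (c : V -> nat) :
  (\sum_v c v = m)%N ->
  (#|[set s : m.-tuple V | [forall v, count_mem v s == c v]]| * \prod_v (c v)`!
   = m`!)%N.
Proof.
elim: m c => [|m IHm] c cm.
  have c0 v : c v = 0%N.
    by move/eqP: cm; rewrite sum_nat_eq0 => /forallP/(_ v) /eqP.
  rewrite big1 ?muln1 => [|v _]; last by rewrite c0.
  apply/eqP/cards1P; exists [tuple]; apply/setP => s; rewrite !inE tuple0.
  by rewrite eqxx; apply/forallP => v; rewrite c0.
rewrite -sum1dep_card.
rewrite (reindex (fun p : V * m.-tuple V => [tuple of p.1 :: p.2])) /=; last first.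
  exists (fun s : m.+1.-tuple V => (thead s, [tuple of behead s])) => [[v s] _|s _].
    by congr pair; apply: val_inj.
  by rewrite -tuple_eta.
pose dec v := fun w => (c w - (w == v))%N.
transitivity (\sum_v c v * m`!)%N; last by rewrite -big_distrl /= cm factS.
rewrite -(pair_big_dep xpredT (fun v (s : m.-tuple V) =>
  [forall w, count_mem w (v :: s) == c w]) (fun _ _ => 1%N)) /= big_distrl /=.
(* If [c v = 0], no sequence starts with [v]; this case is separate because the subtraction in [dec]
   is truncated. *)
apply: eq_bigr => v _; case: (posnP (c v)) => [cv|cv].
  rewrite cv mul0n big1 ?mul0n // => s /forallP/(_ v).
  by rewrite /= eqxx cv.
have decm : (\sum_w dec v w = m)%N.
  move: cm; rewrite (bigD1 v) //= [in X in _ -> X](bigD1 v) //= /dec eqxx => cm.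
  under eq_bigr => w wv do rewrite (negbTE wv) subn0.
  by move: cv cm; clear; lia.
rewrite -(IHm _ decm) -sum1dep_card mulnCA.
have -> : (\prod_w (c w)`! = c v * \prod_w (dec v w)`!)%N.
  rewrite (bigD1 v) //= [in RHS](bigD1 v) //= mulnA /dec eqxx; congr (_ * _)%N.
    by case: (c v) cv => // k _; rewrite factS subn1.
  by apply: eq_bigr => w wv; rewrite (negbTE wv) subn0.
congr (_ * _)%N; rewrite /=; apply: eq_bigl => s.
apply: eq_forallb => w; rewrite /= /dec; case: (eqVneq w v) => [->|_]; last by rewrite add0n subn0.
by apply/eqP/eqP; move: cv; clear; lia.
Qed.

Lemma card_sorted_tuples_content n m (c : 'I_n -> nat) :
  (\sum_v c v = m)%N ->
  #|[set s : m.-tuple 'I_n | sorted (fun i j : 'I_n => (i <= j)%N) s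
       && [forall v, count_mem v s == c v]]| = 1%N.
Proof.
move=> cm; set leI := fun i j : 'I_n => _.
have leI_total : total leI by move=> i j; apply: leq_total.
have leI_trans : transitive leI by move=> i j k; apply: leq_trans.
have leI_anti : antisymmetric leI.
  by move=> i j /anti_leq ij; apply: val_inj.
pose s0 := sort leI (flatten [seq nseq (c v) v | v <- enum 'I_n]).
have s0c v : count_mem v s0 = c v.
  rewrite count_sort count_flatten sumnE 2!big_map big_enum /=.
  rewrite (bigD1 v) //= count_nseq /= eqxx mul1n big1 ?addn0 // => w wv.
  by rewrite count_nseq /= (negbTE wv).
have sz0 : size s0 == m.
  by rewrite -sum_count_mem -cm; apply/eqP/eq_bigr => v _.
apply/eqP/cards1P; exists (Tuple sz0); apply/setP => s; rewrite !inE.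
apply/andP/eqP => [[ss /forallP sc]|->]; last first.
  by split; [apply: sort_sorted | apply/forallP => v; rewrite /= s0c].
apply: val_inj; apply: (sorted_eq leI_trans leI_anti ss); first exact: sort_sorted.
by apply/allP => v _ /=; rewrite s0c; apply: sc.
Qed.

(** [R] is the kind of sequence (all or sorted), while [Q] sees only the content, so the count is a
    sum over contents. An entry of a content is at most [m <= n], which explains [lists n.+1 n]. *)
Lemma card_by_content n m (ls : seq 'I_n) (R : pred (m.-tuple 'I_n))
    (Q : pred (seq nat)) (M : rat) (E : nat -> rat) :
  (m <= n)%N -> perm_eq ls (enum 'I_n) ->
  (forall c : 'I_n -> nat, (\sum_v c v = m)%N ->
     #|[set s | R s && [forall v, count_mem v s == c v]]|%:R = M * \prod_v E (c v)) ->
  #|[set s : m.-tuple 'I_n | R s && Q [seq count_mem v s | v <- ls]]|%:R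
  = M * \sum_(cs <- lists n.+1 n | Q cs && (sumn cs == m)) \prod_(k <- cs) E k.
Proof.
move=> mn permls ME; have sls : size ls = n by rewrite (perm_size permls) size_enum_ord.
have uls : uniq ls by rewrite (perm_uniq permls) enum_uniq.
pose content (s : m.-tuple 'I_n) := [seq count_mem v s | v <- ls].
have sum_ls (f : 'I_n -> nat) : sumn [seq f v | v <- ls] = (\sum_v f v)%N.
  by rewrite sumnE big_map (perm_big _ permls) big_enum.
have content_in s : content s \in lists n.+1 n.
  rewrite mem_lists size_map sls eqxx; apply/allP => _ /mapP[v _ ->].
  by rewrite ltnS (leq_trans (count_size _ _)) // size_tuple.
have content_sum s : sumn (content s) = m by rewrite sum_ls sum_count_mem size_tuple.
rewrite -sum1dep_card natr_sum mulr_sumr.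
transitivity (\sum_(cs <- lists n.+1 n | Q cs && (sumn cs == m))
  \sum_(s : m.-tuple 'I_n | R s && (content s == cs)) (1 : rat)).
  rewrite (exchange_big_dep (fun s => R s && Q (content s))) /=.
    apply: eq_bigr => s /andP[Rs Qs].
    rewrite (big_rem (content s)) //= Qs content_sum eqxx Rs eqxx /=.
    rewrite big_seq_cond big1 ?addr0 // => cs /andP[].
    rewrite (mem_rem_uniq _ (lists_uniq _ _)) !inE => /andP[/negbTE ncs _].
    by rewrite [content s == _]eq_sym ncs !andbF.
  by move=> cs s /andP[Qcs _] /andP[-> /eqP ->].
rewrite big_seq_cond [RHS]big_seq_cond; apply: eq_bigr => cs.
rewrite mem_lists => /andP[/andP[/eqP scs _] /andP[_ /eqP smcs]].
pose c v := nth 0%N cs (index v ls).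
have csE : cs = [seq c v | v <- ls].
  apply: (@eq_from_nth _ 0%N) => [|i]; rewrite ?size_map scs ?sls // => iN.
  have i0 : 'I_n by exists i.
  by rewrite (nth_map i0) ?sls // /c index_uniq ?sls.
have cm : (\sum_v c v = m)%N by rewrite -sum_ls -csE.
rewrite [in RHS]csE big_map (perm_big _ permls) big_enum -ME //.
rewrite -sum1dep_card natr_sum; apply: eq_bigl => s; congr (_ && _).
rewrite csE; apply/eqP/forallP => [/eq_in_map sc v|sc].
  by rewrite sc // (perm_mem permls) mem_enum.
by apply/eq_in_map => v _; apply/eqP.
Qed.

Lemma prod_fact_inv (V : finType) (c : V -> nat) :
  \prod_v exp_series (c v) = (\prod_v (c v)`!)%:R^-1.
Proof. by rewrite natr_prod -prodfV. Qed.

Section CountingPreferences.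
Variables (n m : nat) (A : family) (T : pretree A n) (B : lforest 'I_n) (r : 'I_n).
Hypotheses (TB : realizes T B r) (mn : (m <= n)%N).

Let permB : perm_eq (labels B) (enum 'I_n). Proof. by case: TB. Qed.

Lemma card_parking_functions :
  #|[set s : m.-tuple 'I_n | parking_function T s]|%:R
  = m`!%:R * \sum_(cs <- lists n.+1 n | (flow (unlabel B) cs == 0%N) && (sumn cs == m))
               \prod_(k <- cs) exp_series k.
Proof.
rewrite -(@card_by_content n m (labels B) xpredT (fun cs => flow (unlabel B) cs == 0%N)) //.
  congr (_%:R); apply: eq_card => s; rewrite !inE /=.
  exact: parking_functionE TB s.
move=> c cm; rewrite prod_fact_inv -(card_tuples_content cm) natrM mulfK //.
by rewrite pnatr_eq0 -lt0n prodn_gt0 // => v; apply: fact_gt0.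
Qed.

Lemma card_parking_distributions :
  #|[set s : m.-tuple 'I_n | parking_distribution T s]|%:R
  = \sum_(cs <- lists n.+1 n | (flow (unlabel B) cs == 0%N) && (sumn cs == m))
      \prod_(k <- cs) geo_series k.
Proof.
rewrite -[RHS]mul1r -(@card_by_content n m (labels B)
  (fun s => sorted (fun i j : 'I_n => (i <= j)%N) s) (fun cs => flow (unlabel B) cs == 0%N)) //.
  congr (_%:R); apply: eq_card => s; rewrite !inE /= andbC; congr (_ && _).
  exact: parking_functionE TB s.
by move=> c cm; rewrite (card_sorted_tuples_content cm) big1 // mulr1.
Qed.
End CountingPreferences.

(** * The tree families *)

(* a k weights the lists of k children: it is the number of configurations with a
   given list, except in the unordered family, where each of the k! orders of the
   children gets the weight 1/k!. *)
Definition family_gf (A : family) (a : fps rat) :=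
  forall n (l : seq 'I_n), uniq l ->
    #|[set c : config A n | perm_eq (kids c) l]|%:R
    = a (size l) * (size l)`!%:R :> rat.

(** For families that see the order of the children: the orders of [l] are distinct lists, each with
    the same number of configurations. *)
Lemma family_gfI (A : family) (a : fps rat) :
  (forall n (l : seq 'I_n), (size l <= n)%N ->
     #|[set c : config A n | kids c == l]|%:R = a (size l) :> rat) ->
  family_gf A a.
Proof.
move=> Aa n l ul.
have sl : (size l <= n)%N by rewrite -(card_uniqP ul) -[leqRHS]card_ord max_card.
transitivity (\sum_(l' <- permutations l)
    #|[set c : config A n | kids c == l']|%:R : rat).
  rewrite -sum1dep_card natr_sum.
  under [RHS]eq_bigr => l' _ do rewrite -sum1dep_card natr_sum.
  rewrite big_seq (exchange_big_dep (fun c => perm_eq (kids c) l)) /=; last first.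
    by move=> l' c; rewrite mem_permutations => l'l /eqP ->.
  apply: eq_bigr => c cl.
  rewrite -big_filter (perm_big [:: kids c]) ?big_seq1 //.
  apply: uniq_perm; rewrite ?filter_uniq ?permutations_uniq // => l'.
  rewrite mem_filter mem_permutations !inE [kids c == _]eq_sym.
  by case: eqP => [->|]; rewrite ?cl ?andbF.
rewrite (eq_big_seq (fun=> a (size l))) => [|l'].
  by rewrite big_const_seq count_predT size_permutations // iter_addr_0 mulr_natr.
by rewrite mem_permutations => /perm_size l'l; rewrite Aa l'l.
Qed.

Lemma ordered_gf : family_gf ordered (geo_series ^+ 1).
Proof.
apply: family_gfI => n l sl; rewrite expr1.
suff -> : [set c : config ordered n | kids c == l] = [set Bseq sl] by rewrite cards1.
by apply/setP => c; rewrite !inE -val_eqE.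
Qed.

Lemma unordered_gf : family_gf unordered exp_series.
Proof.
move=> n l ul; rewrite /exp_series /= mulVf; last by rewrite pnatr_eq0 -lt0n fact_gt0.
suff -> : [set c : config unordered n | perm_eq (kids c) l] = [set [set x in l]].
  by rewrite cards1.
apply/setP => S; rewrite !inE; apply/idP/eqP => [Sl|->].
  by apply/setP => x; rewrite inE -(perm_mem Sl) mem_enum.
by apply: uniq_perm; rewrite ?enum_uniq // => x; rewrite mem_enum inE.
Qed.

(** One more position cuts [l] into a prefix, held by that position, and the rest; summing over the
    cut is the convolution in [b ^+ d.+1]. The bound [N] accommodates the bounded sequences of
    bundled trees. *)
Lemma card_flatten (C V : finType) (k : C -> seq V) (b : fps rat) N d l :
  (forall l, (size l <= N)%N -> #|[set c | k c == l]|%:R = b (size l)) ->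
  (size l <= N)%N ->
  #|[set f : {ffun 'I_d -> C} | flatten [seq k (f i) | i <- enum 'I_d] == l]|%:R
  = (b ^+ d) (size l).
Proof.
move=> kb; elim: d l => [|d IHd] l lN.
  have c1 : #|{ffun 'I_0 -> C}| = 1%N by rewrite card_ffun card_ord expn0.
  have e0 : enum 'I_0 = [::] by apply: size0nil; rewrite size_enum_ord.
  rewrite expr0 e0 /= eq_sym; case: l {lN} => [|x l] /=.
    by rewrite (@eq_card _ _ predT) ?c1 // => f; rewrite !inE.
  by rewrite eq_card0 // => f; rewrite !inE.
pose cons (p : C * {ffun 'I_d -> C}) : {ffun 'I_d.+1 -> C} :=
  [ffun i => if unlift ord0 i is Some j then p.2 j else p.1].
rewrite -sum1dep_card natr_sum (reindex cons) /=; last first.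
  exists (fun f => (f ord0, [ffun i => f (lift ord0 i)])) => [[c g] _|f _] /=.
    congr pair; first by rewrite ffunE unlift_none.
    by apply/ffunP => i; rewrite !ffunE liftK.
  apply/ffunP => i; rewrite ffunE /=.
  by case: unliftP => [j|] ->; rewrite ?ffunE.
have flatE c g : flatten [seq k (cons (c, g) i) | i <- enum 'I_d.+1]
    = k c ++ flatten [seq k (g i) | i <- enum 'I_d].
  rewrite enum_ordSl /= ffunE unlift_none -map_comp; congr (_ ++ flatten _).
  by apply: eq_map => i; rewrite /= ffunE liftK.
(* The cut [i] becomes a summation index; only [i = size (k p.1)] can contribute. *)
transitivity (\sum_(p : C * {ffun 'I_d -> C}) \sum_(i < (size l).+1)
    ((k p.1 == take i l) && (flatten [seq k (p.2 j) | j <- enum 'I_d] == drop i l))%:R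
    : rat).
  rewrite big_mkcond; apply: eq_bigr => -[c g] _; rewrite flatE /=.
  case: eqP => [El|nEl].
    have ic : (size (k c) < (size l).+1)%N by rewrite ltnS -El size_cat leq_addr.
    have e1 : k c == take (size (k c)) l by rewrite -El take_size_cat.
    have e2 : flatten [seq k (g j) | j <- enum 'I_d] == drop (size (k c)) l.
      by rewrite -El drop_size_cat.
    rewrite (bigD1 (Ordinal ic)) //= e1 e2.
    rewrite big1 ?addr0 // => i ni; case: eqP => //= ki; case/eqP: ni.
    apply: val_inj; rewrite /= ki size_take_min.
    by apply/esym/minn_idPl; rewrite -ltnS.
  rewrite big1 // => i _; case: eqP => //= ki; case: eqP => // gi.
  by case: nEl; rewrite ki gi cat_take_drop.
rewrite exchange_big exprS coef_mulE; apply: eq_bigr => i _.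
have il : (i <= size l)%N by rewrite -ltnS.
rewrite -(pair_bigA _ (fun c (g : {ffun 'I_d -> C}) =>
  ((k c == take i l) && (flatten [seq k (g j) | j <- enum 'I_d] == drop i l))%:R)) /=.
transitivity (#|[set c | k c == take i l]|%:R
  * #|[set f : {ffun 'I_d -> C} | flatten [seq k (f i) | i <- enum 'I_d] == drop i l]|%:R
  : rat).
  rewrite -!sum1dep_card !natr_sum big_distrlr /= [RHS]big_mkcond.
  apply: eq_bigr => c _; case: eqP => _ /=; last by rewrite big1.
  by rewrite [RHS]big_mkcond; apply: eq_bigr => g _; rewrite mulr1; case: eqP.
rewrite kb ?IHd ?size_drop ?size_take_min; first by rewrite (minn_idPl il).
  by apply: leq_trans lN; apply: leq_subr.
by rewrite (minn_idPl il) (leq_trans il).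
Qed.

Lemma bundled_gf d : family_gf (d_bundled d) (geo_series ^+ d).
Proof.
apply: family_gfI => n l sl.
apply: (@card_flatten _ _ (fun c : {bseq n of 'I_n} => c : seq 'I_n) _ n) => // l' sl'.
suff -> : [set c : {bseq n of 'I_n} | (c : seq 'I_n) == l'] = [set Bseq sl'].
  by rewrite cards1.
by apply/setP => c; rewrite !inE -val_eqE.
Qed.

Lemma d_ary_gf d : family_gf (d_ary d) ((1 + fpsX _) ^+ d).
Proof.
apply: family_gfI => n l sl.
pose k (o : option 'I_n) := if o is Some x then [:: x] else [::].
rewrite -(@card_flatten _ _ k (1 + fpsX _) n) => // [|l' _].
  congr (_%:R); apply: eq_card => f; rewrite !inE /=; congr (_ == _).
  by elim: (enum 'I_d) => //= i s ->; case: (f i).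
case: l' => [|x [|y l']].
- rewrite (@eq_card _ _ (pred1 None)) ?card1 /= ?addr0 // => -[x|];
    by rewrite !inE.
- rewrite (@eq_card _ _ (pred1 (Some x))) ?card1 /= ?add0r // => -[y|];
    by rewrite !inE //= /k eqseq_cons eqxx andbT.
rewrite eq_card0 /= ?addr0 // => -[z|];
  by rewrite !inE //= /k eqseq_cons andbF.
Qed.

(** * Reordering children: reduction to ordered trees *)

Section Transfer.
Variables (n : nat) (A A' : family) (T : pretree A n) (T' : pretree A' n).
Hypothesis TT' : forall v, perm_eq (kids (T v)) (kids (T' v)).

Lemma eq_is_tree : is_tree T = is_tree T'.
Proof.
apply: eq_existsb => r; congr (_ && _).
  have : perm_eq (r :: flatten [seq kids (T v) | v <- enum 'I_n])
                 (r :: flatten [seq kids (T' v) | v <- enum 'I_n]).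
    rewrite perm_cons; apply/permP => p; rewrite !count_flatten !sumnE !big_map.
    by apply: eq_bigr => v _; apply/permP.
  by move/permPl.
apply: eq_forallb => v; apply: eq_connect => x y.
exact: perm_mem.
Qed.

Lemma eq_parent : parent T =1 parent T'.
Proof. by move=> v; apply: eq_pick => w; apply: perm_mem. Qed.

Lemma eq_parking_function s : parking_function T s = parking_function T' s.
Proof.
rewrite /parking_function eq_is_tree; congr (_ && all _ _).
have eq_ff occ k v : first_free T occ k v = first_free T' occ k v.
  by elim: k v => //= k IHk v; rewrite eq_parent;
    case: (parent T' v) => [w|] //; rewrite IHk.
elim: s set0 => //= v s IHs occ; rewrite /park eq_ff.
by congr (_ :: _); rewrite IHs.
Qed.

Lemma eq_parking_distribution s :
  parking_distribution T s = parking_distribution T' s.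
Proof. by rewrite /parking_distribution eq_parking_function. Qed.
End Transfer.

Section Reordering.
Variables (n : nat) (A : family) (a : fps rat).
Hypothesis A_gf : family_gf A a.

Let same (T : pretree A n) (T' : pretree ordered n) :=
  [forall v, perm_eq (kids (T v)) (kids (T' v))].

Lemma tree_kids_uniq (A' : family) (T : pretree A' n) v :
  is_tree T -> uniq (kids (T v)).
Proof.
case/existsP=> r /andP[pT _].
have := perm_uniq pT; rewrite enum_uniq /= => /andP[_].
have : v \in enum 'I_n by rewrite mem_enum.
by elim: (enum 'I_n) => //= w s IHs; rewrite inE cat_uniq
  => /predU1P[-> /and3P[]//|/IHs vs /and3P[_ _ /vs]].
Qed.

Lemma card_reorderings (A1 A2 : family) (b : fps rat) (T : pretree A1 n) :
  family_gf A2 b -> is_tree T ->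
  #|[set T' : pretree A2 n | [forall v, perm_eq (kids (T' v)) (kids (T v))]]|%:R
  = \prod_v (b (size (kids (T v))) * (size (kids (T v)))`!%:R) :> rat.
Proof.
move=> A2b treeT.
transitivity (\prod_v \sum_(c : config A2 n | perm_eq (kids c) (kids (T v))) (1 : rat)).
  rewrite (bigA_distr_big_dep (fun v (c : config A2 n) => perm_eq (kids c) (kids (T v)))).
  rewrite -sum1dep_card natr_sum; apply: eq_big => [T'|T' _].
    by apply/forallP/familyP => H v; apply: H.
  by rewrite big1.
apply: eq_bigr => v _.
by rewrite -(A2b _ _ (tree_kids_uniq v treeT)) -sum1dep_card natr_sum.
Qed.

(** A double count of pairs of a tree [T] and an ordering [T'] of its children, with weight 1/F.
    With k_v the number of children of v, [T] has prod k_v! orderings, and [T'] arises from prod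
    a(k_v) k_v! trees of the family. *)
Lemma sum_reorder (f : pretree A n -> rat) (g : pretree ordered n -> rat) :
  (forall (T : pretree A n) (T' : pretree ordered n),
     (forall v, perm_eq (kids (T v)) (kids (T' v))) -> f T = g T') ->
  \sum_(T | is_tree T) f T
  = \sum_(T' | is_tree T') (\prod_v a (size (kids (T' v)))) * g T'.
Proof.
move=> fg; pose F (T' : pretree ordered n) : rat := \prod_v (size (kids (T' v)))`!%:R.
have F0 T' : F T' != 0.
  by apply/prodf_neq0 => v _; rewrite pnatr_eq0 -lt0n fact_gt0.
transitivity (\sum_(T | is_tree T) \sum_(T' | same T T') (g T' / F T')).
  apply: eq_bigr => T treeT.
  have := card_reorderings ordered_gf treeT.
  rewrite [X in _ = X -> _](eq_bigr (fun v => (size (kids (T v)))`!%:R)) => [card_same|v _];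
    last by rewrite expr1 /= mul1r.
  transitivity (\sum_(T' | same T T') (f T / \prod_v (size (kids (T v)))`!%:R)).
    rewrite sumr_const -[f T in LHS]mulr1.
    have -> : #|same T| = #|[set T' : pretree ordered n |
        [forall v, perm_eq (kids (T' v)) (kids (T v))]]|.
      apply: eq_card => T'; rewrite !inE; apply: eq_forallb => v; exact: perm_sym.
    rewrite -[RHS]mulr_natr card_same divfK ?mulr1 //.
    by apply/prodf_neq0 => v _; rewrite pnatr_eq0 -lt0n fact_gt0.
  apply: eq_bigr => T' /forallP TT'; rewrite (fg T T' TT'); congr (_ / _).
  by apply: eq_bigr => v _; rewrite (perm_size (TT' v)).
rewrite (exchange_big_dep (@is_tree ordered n)) /=; last first.
  by move=> T T' treeT /forallP TT'; rewrite -(eq_is_tree TT').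
apply: eq_bigr => T' treeT'.
rewrite (eq_bigl (fun T => same T T')) => [|T]; last first.
  rewrite andbC; case: (boolP (same T T')) => //= /forallP TT'.
  by rewrite (eq_is_tree TT').
rewrite sumr_const -[LHS]mulr_natr.
have -> : #|(same)^~ T'| = #|[set T : pretree A n |
    [forall v, perm_eq (kids (T v)) (@kids ordered n (T' v))]]|.
  by apply: eq_card => T; rewrite !inE.
rewrite (card_reorderings A_gf treeT') big_split /= -/(F T') mulrCA divfK //.
Qed.
End Reordering.

Lemma prod_degree_weight (V : finType) (kappa : V -> seq V) B (a : fps rat) :
  real kappa B ->
  \prod_(v <- labels B) a (size (kappa v)) = degree_weight a (unlabel B).
Proof.
elim: B => [|v l IHl r IHr] /=; first by rewrite big_nil.
move=> /and3P[/eqP kl rl rr]; rewrite big_cons big_cat /= IHl // IHr //.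
by rewrite kl size_root_labels mulrA.
Qed.

(** * From parking counts to the tree series *)

Section TreeSeriesOfCounts.
Variables (A : family) (a E : fps rat) (M : nat -> rat).
Variable ok : forall (A' : family) n m, pretree A' n -> pred (m.-tuple 'I_n).
Hypothesis A_gf : family_gf A a.
Hypothesis M0 : forall m, M m != 0.
Hypothesis ok_tree : forall n m (T : pretree A n) (s : m.-tuple 'I_n),
  ok T s -> is_tree T.
Hypothesis ok_same : forall n m (T : pretree A n) (T' : pretree ordered n)
  (s : m.-tuple 'I_n), (forall v, perm_eq (kids (T v)) (kids (T' v))) ->
  ok T s = ok T' s.
Hypothesis ok_card : forall n m (T : pretree ordered n) B r,
  realizes T B r -> (m <= n)%N ->
  #|[set s : m.-tuple 'I_n | ok T s]|%:R
  = M m * \sum_(cs <- lists n.+1 n | (flow (unlabel B) cs == 0%N) && (sumn cs == m))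
            \prod_(k <- cs) E k.

(** [sum_reorder] reduces to ordered trees and [sum_ordered_trees] to shapes. [M m] is m! for
    functions and 1 for distributions, and matches the normalization of the generating function. *)
Lemma card_pairs n m : (0 < n)%N -> (m <= n)%N ->
  #|[set Ts : pretree A n * m.-tuple 'I_n | ok Ts.1 Ts.2]|%:R
  = n`!%:R * M m * \sum_(s <- forests n | (nroots s == 1%N) && (nodes s == n))
      degree_weight a s
      * \sum_(cs <- lists n.+1 n | (flow s cs == 0%N) && (sumn cs == m))
          \prod_(k <- cs) E k.
Proof.
move=> n_gt0 mn.
pose cnt (A' : family) (T : pretree A' n) : rat := #|[set s : m.-tuple 'I_n | ok T s]|%:R.
transitivity (\sum_(T : pretree A n | is_tree T) cnt A T).
  rewrite -sum1dep_card natr_sum [RHS]big_mkcond.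
  rewrite -(pair_big_dep xpredT (fun (T : pretree A n) (s : m.-tuple 'I_n) => ok T s)
    (fun _ _ => 1)) /=.
  apply: eq_bigr => T _; case: ifP => treeT.
    by rewrite /cnt -sum1dep_card natr_sum.
  by rewrite big1 // => s /ok_tree; rewrite treeT.
rewrite (sum_reorder A_gf (g := cnt ordered)); last first.
  by move=> T T' TT'; congr (_%:R); apply: eq_card => s; rewrite !inE (ok_same _ TT').
pose g s := M m * (degree_weight a s
  * \sum_(cs <- lists n.+1 n | (flow s cs == 0%N) && (sumn cs == m))
      \prod_(k <- cs) E k).
rewrite (sum_ordered_trees (g := g) n_gt0) => [|T B r TB].
  by rewrite -mulr_sumr -[LHS]mulr_natl mulrA.
rewrite /cnt (ok_card TB mn) /g mulrCA; congr (_ * (_ * _)).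
have [rB _ permB] := TB.
by rewrite -(prod_degree_weight a rB) (perm_big _ permB) big_enum.
Qed.

Lemma tree_gf_counts : tree_gf a E
  (Fps (fun n => if n == 0%N then 0 else
    \sum_(m < n.+1)
      (#|[set Ts : pretree A n * m.-tuple 'I_n | ok Ts.1 Ts.2]|%:R
       / (n`!%:R * M m)) *: 'X^(n - m))).
Proof.
apply: tree_gfI => n; rewrite [LHS]/= coef_sumE.
case: (posnP n) => [->|n_gt0].
  by rewrite big_cons big_nil.
pose S s m : rat := \sum_(cs <- lists n.+1 n | (flow s cs == 0%N) && (sumn cs == m))
  \prod_(k <- cs) E k.
transitivity (\sum_(m < n.+1)
   \sum_(s <- forests n | (nroots s == 1%N) && (nodes s == n))
     (degree_weight a s * S s m) *: ('X^(n - m) : {poly rat})).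
  apply: eq_bigr => m _; have mn : (m <= n)%N by rewrite -ltnS.
  have nM : n`!%:R * M m != 0 by rewrite mulf_neq0 ?M0 // pnatr_eq0 -lt0n fact_gt0.
  rewrite -scaler_suml; congr (_ *: _).
  by rewrite (card_pairs n_gt0 mn) mulrAC (divff nM) mul1r.
rewrite exchange_big /=; apply: eq_bigr => s /andP[_ /eqP sn].
rewrite (@weight_coef0 _ _ _ _ _ n.+1) ?sn // mulr_sumr.
transitivity (\sum_(m < n.+1)
    \sum_(cs <- lists n.+1 n | (flow s cs == 0%N) && (sumn cs == m))
      (degree_weight a s)%:P * ((\prod_(k <- cs) E k)%:P * 'X^(n - sumn cs))).
  apply: eq_bigr => m _; rewrite -scalerA -mul_polyC -mulr_sumr; congr (_ * _).
  rewrite /S scaler_suml; apply: eq_bigr => cs /andP[_ /eqP ->].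
  by rewrite mul_polyC.
rewrite (exchange_big_dep (fun cs => flow s cs == 0%N)) /=; last first.
  by move=> m cs _ /andP[].
rewrite big_seq_cond [RHS]big_seq_cond; apply: eq_bigr => cs.
rewrite mem_lists => /andP[/andP[/eqP scs _] /eqP f0].
(* When nobody leaves there are at most [n] drivers, so [cs] belongs to exactly one [m] of the
   range. *)
have sumn_le : (sumn cs < n.+1)%N.
  by have := @flow_free s cs; rewrite scs sn f0 => /(_ erefl); lia.
rewrite (big_pred1 (Ordinal sumn_le)) // => m.
by rewrite f0 /= eq_sym.
Qed.
End TreeSeriesOfCounts.

Lemma tree_gf_functions (A : family) (a : fps rat) : family_gf A a ->
  tree_gf a exp_series (gf_functions A).
Proof.
move=> A_gf; apply: (@tree_gf_counts A a exp_series (fun m => m`!%:R)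
  (fun A' n m T s => parking_function T s)) => //.
- by move=> m; rewrite pnatr_eq0 -lt0n fact_gt0.
- by move=> n m T s /andP[].
- by move=> n m T T' s TT'; apply: eq_parking_function.
by move=> n m T B r TB mn; apply: card_parking_functions TB mn.
Qed.

Lemma tree_gf_distributions (A : family) (a : fps rat) : family_gf A a ->
  tree_gf a geo_series (gf_distributions A).
Proof.
move=> A_gf.
have -> : gf_distributions A = Fps (fun n => if n == 0%N then 0 else
    \sum_(m < n.+1)
      (#|[set Ts : pretree A n * m.-tuple 'I_n | parking_distribution Ts.1 Ts.2]|%:R
       / (n`!%:R * 1)) *: 'X^(n - m)).
  by apply: fpsP => n /=; case: ifP => // _; apply: eq_bigr => m _; rewrite mulr1.
apply: (@tree_gf_counts A a geo_series (fun=> 1)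
  (fun A' n m T s => parking_distribution T s)) => //.
- by move=> n m T s /andP[/andP[]].
- by move=> n m T T' s TT'; apply: eq_parking_distribution.
by move=> n m T B r TB mn; rewrite mul1r; apply: card_parking_distributions TB mn.
Qed.

Theorem theorem2p4 :
  let z := zvar in
  let u := uvar in
  (given_by (gf_functions ordered)
     (fun Q => 1 - ((1 - Q) * (1 + Q + u * Q * (1 - Q)) * expS Q)^-1)
     (fun Q => z * (1 + Q + u * Q * (1 - Q)) ^+ 2 * expS Q))
  /\
  (given_by (gf_functions unordered)
     (fun Q => lnS (1 - Q) + Q * (2%:R + u * (1 - Q)))
     (fun Q => z * expS (Q * (2%:R + u * (1 - Q)))))
  /\
  (forall d : nat, (1 <= d)%N ->
   given_by (gf_functions (d_ary d))
     (fun Q => powS (1 - d%:R * Q) (d%:R^-1) * expS Q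
               / (1 - Q - u * Q * (1 - d%:R * Q)) - 1)
     (fun Q => z * expS (d%:R * Q)
               / (1 - Q - u * Q * (1 - d%:R * Q)) ^+ (d - 1)))
  /\
  (forall d : nat, (1 <= d)%N ->
   given_by (gf_functions (d_bundled d))
     (fun Q => 1 - (powS (1 - d%:R * Q) (d%:R^-1)
                    * (1 + Q + u * Q * (1 - d%:R * Q)) * expS Q)^-1)
     (fun Q => z * (1 + Q + u * Q * (1 - d%:R * Q)) ^+ (d + 1)
               * expS (d%:R * Q)))
  /\
  (given_by (gf_distributions ordered)
     (fun Q => 1 - ((1 - Q) * ((1 + Q) ^+ 2 + u * Q * (1 - Q)))^-1)
     (fun Q => z * ((1 + Q) ^+ 2 + u * Q * (1 - Q)) ^+ 2))
  /\
  (given_by (gf_distributions unordered)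
     (fun Q => Q + lnS (1 + Q) + lnS (1 - Q) + u * Q * (1 - Q) / (1 + Q))
     (fun Q => z * (1 + Q) ^+ 2 * expS (Q * (1 + u * (1 - Q) / (1 + Q)))))
  /\
  (forall d : nat, (1 <= d)%N ->
   given_by (gf_distributions (d_ary d))
     (fun Q => powS (1 + Q) (d%:R^-1) * powS (1 - Q) (d%:R^-1)
               / (1 - Q / d%:R - u * Q * (1 - Q) / (d%:R * (1 + Q))) - 1)
     (fun Q => d%:R * z * (1 + Q) ^+ 2
               / (1 - Q / d%:R - u * Q * (1 - Q) / (d%:R * (1 + Q)))
                 ^+ (d - 1)))
  /\
  (forall d : nat, (1 <= d)%N ->
   given_by (gf_distributions (d_bundled d))
     (fun Q => 1 - (powS (1 + Q) (d%:R^-1) * powS (1 - Q) (d%:R^-1)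
                    * (1 + Q / d%:R
                       + u * Q * (1 - Q) / (d%:R * (1 + Q))))^-1)
     (fun Q => d%:R * z * (1 + Q) ^+ 2
               * (1 + Q / d%:R + u * Q * (1 - Q) / (d%:R * (1 + Q)))
                 ^+ (d + 1))).

Proof.
move=> z u.
split; first exact: ordered_functions (tree_gf_functions ordered_gf).
split; first exact: unordered_functions (tree_gf_functions unordered_gf).
split=> [d d_gt0|].
  exact: d_ary_functions d_gt0 (tree_gf_functions (d_ary_gf d)).
split=> [d d_gt0|].
  exact: bundled_functions d_gt0 (tree_gf_functions (bundled_gf d)).
split; first exact: ordered_distributions (tree_gf_distributions ordered_gf).
split; first exact: unordered_distributions (tree_gf_distributions unordered_gf).
split=> d d_gt0.
  exact: d_ary_distributions d_gt0 (tree_gf_distributions (d_ary_gf d)).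
exact: bundled_distributions d_gt0 (tree_gf_distributions (bundled_gf d)).
Qed.
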